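(* The following is provable in $\mathrm{BZFC}$: for all sets $A$ and $B$, $$|A|=|B|\;\Leftrightarrow\; A\cong B,$$ i.e. $|A|=|B|$ is true iff $A\cong B$ is true, and $|A|=|B|$ is false iff $A\cong B$ is false.
   Context: Logic. The background logic is the four-valued first-order logic BS4 with primitives $\sim,\land,\lor,\rightarrow,\leftrightarrow,\bot,\forall,\exists$. A model has a non-empty domain $M$, the usual interpretations of constants and function symbols, and, for each $n$-ary relation symbol $R$, two independent interpretations $R^+,R^-\subseteq M^n$; $=^+$ is true identity and $=^-$ is a symmetric relation. Truth and falsity are defined simultaneously (a formula may be true, false, both, or neither): an atomic formula is true/false according to $R^+$/$R^-$; $\sim\varphi$ is true iff $\varphi$ is false, and false iff $\varphi$ is true; $\varphi\land\psi$ is true iff both are true, false iff at least one is false; $\lor$ dually; $\varphi\rightarrow\psi$ is true iff ($\varphi$ true implies $\psi$ true), false iff $\varphi$ is true and $\psi$ is false; $\varphi\leftrightarrow\psi$ is true iff ($\varphi$ true iff $\psi$ true), false iff ($\varphi$ true and $\psi$ false) or ($\varphi$ false and $\psi$ true); $\forall$ is true iff all instances are true, false iff some instance is false; $\exists$ is true iff some instance is true, false iff all instances are false; $\bot$ is false and not true. $\Gamma\vDash\varphi$ iff $\varphi$ is true in every model in which all of $\Gamma$ is true. Asserting a formula means asserting that it is true; English ''iff'', ''if/then'', ''and'', ''or'' between formulas concern truth. Abbreviations: $\neg\varphi:=\varphi\rightarrow\bot$ (true iff $\varphi$ is not true); $!\varphi:=\sim\neg\varphi$ (two-valued, true iff $\varphi$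 is true); $?\varphi:=\neg\sim\varphi$ (two-valued, true iff $\varphi$ is not false); $\circ\varphi:=\,!\varphi\leftrightarrow ?\varphi$; $\varphi\Rightarrow\psi:=(\varphi\rightarrow\psi)\land(\sim\psi\rightarrow\sim\varphi)$; $\varphi\Leftrightarrow\psi:=(\varphi\leftrightarrow\psi)\land(\sim\varphi\leftrightarrow\sim\psi)$; $\varphi\,\&\,\psi:=\,\sim(\varphi\rightarrow\sim\psi)$; $\exists x\in A\,\varphi:=\exists x(x\in A\,\&\,\varphi)$; $\forall x\in A\,\varphi:=\forall x(x\in A\rightarrow\varphi)$. A slashed relation symbol ($\neq,\notin,\not\subseteq,\not\cong,\not\preceq$) is the $\sim$-negation of the relation. Set theory. $\mathrm{BZFC}$ is a BS4-theory in the language $\{\in,=\}$ whose objects are called sets. It includes: Extensionality $\forall A\forall B(A=B\Leftrightarrow\forall x(x\in A\Leftrightarrow x\in B))$; Comprehension $\forall A\exists B\forall x(x\in B\Leftrightarrow x\in A\land\varphi(x))$; ACLA: $\exists A(A^!\not\subseteq A^?)\land\exists A(A^?\not\subseteq A^!)$; Choice: every classical set of non-empty sets has a choice function. Here $A=\{x:\varphi(x)\}$ means $\forall x(x\in A\Leftrightarrow\varphi(x))$; $A\subseteq B:=\forall x(x\in A\Rightarrow x\in B)$; $A$ is classical if $\forall x\,{\circ}(x\in A)$; $A^!:=\{x:{!}(x\in A)\}$ and $A^?:=\{x:{?}(x\in A)\}$. The remaining axioms are suitable analogues of those of $\mathrm{ZFC}$; available consequences are: $A^!,A^?$ are (classical)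 sets; $A\subseteq B\leftrightarrow(A^!\subseteq B^!\land A^?\subseteq B^?)$, $A\not\subseteq B\leftrightarrow A^!\not\subseteq B^?$, $A=B\leftrightarrow(A^!=B^!\land A^?=B^?)$, $A\neq B\leftrightarrow(A^!\not\subseteq B^?\lor B^!\not\subseteq A^?)$; for all classical sets $X,Y$ there is a unique set $\langle X|Y\rangle$ with $\langle X|Y\rangle^!=X$, $\langle X|Y\rangle^?=Y$; ordered pairs (and triples) are encoded so that $(a,b)=(c,d)\Leftrightarrow(a=c\land b=d)$; usual $\mathrm{ZFC}$ set theory (including choice and von Neumann ordinals, which live in the inner $\mathrm{ZFC}$-model of hereditarily classical sets) applies to classical sets, whose elements may be arbitrary sets. For a classical set $X$, $|X|_{Cl}$ is the least von Neumann ordinal in bijection with $X$. Put $A_{\mathbf b}:=A^!\setminus A^?$, $A_{\mathbf t}:=A^!\cap A^?$, $A_{\mathbf n}:=A^?\setminus A^!$, $\mathrm{rlm}(A):=A^!\cup A^?$ (all classical sets). Functions and equinumerosity. A classical function is a classical set $f$ of ordered pairs with $((a,b)\in f\land(a,c)\in f)\rightarrow{!}(b=c)$; it is an injection if $((a,c)\in f\land(b,c)\in f)\rightarrow{!}(a=b)$. For $A\subseteq\mathrm{dom}(f)$, $f[A]:=\{y:\exists x(y=f(x)\,\&\,x\in A)\}$, so $f[A]^!=f[A^!]$ and $f[A]^?=f[A^?]$. A counting of $A$ is an injection with domain $\mathrm{rlm}(A)$; $\mathrm{Count}(A)$ is the class of countings of $A$. Define $$A\cong B:=\exists f\in\mathrm{Count}(A)\,\exists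 g\in\mathrm{Count}(B)\,(f[A]=g[B]).$$ Thus $A\not\cong B$ is true iff $f[A]\neq g[B]$ for all $f\in\mathrm{Count}(A)$, $g\in\mathrm{Count}(B)$. Cardinal numbers. The cardinal number of $A$ is the triple $|A|:=(X,Y,Z)$ with $$X:=\big\langle |A^!|_{Cl}\,\big|\,|A^?|_{Cl}\big\rangle,\quad Y:=\big\langle |A_{\mathbf t}|_{Cl}\,\big|\,|A^?|_{Cl}\big\rangle,\quad Z:=\big\langle |A_{\mathbf b}|_{Cl}\,\big|\,|A_{\mathbf n}|_{Cl}\big\rangle.$$ *)

(* Defs.v *)
From Stdlib Require Import Arith.

(** * The four-valued logic BS4 over the language {∈, =} *)

Inductive form : Type :=
| In : nat -> nat -> form
| Eq : nat -> nat -> form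
| Neg : form -> form
| And : form -> form -> form
| Or : form -> form -> form
| Imp : form -> form -> form
| Iff : form -> form -> form
| Bot : form
| All : nat -> form -> form
| Ex : nat -> form -> form.

(** A truth value says separately whether a formula is true and whether it is
    false; the two are independent. *)
Record four : Type := Four { is_true : Prop; is_false : Prop }.

(** [=^+] is Leibniz equality on the carrier, so only [=^-] is a field. *)
Record model : Type := Model {
  carrier :> Type;
  inhab : inhabited carrier;
  in_pos : carrier -> carrier -> Prop;
  in_neg : carrier -> carrier -> Prop;
  eq_neg : carrier -> carrier -> Prop;
  eq_neg_sym : forall a b, eq_neg a b -> eq_neg b a
}.

Definition update {M : Type} (e : nat -> M) (x : nat) (a : M) : nat -> M :=
  fun y => if Nat.eqb y x then a else e y.

Fixpoint eval (M : model) (e : nat -> M) (phi : form) : four :=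
  match phi with
  | In x y => Four (in_pos M (e x) (e y)) (in_neg M (e x) (e y))
  | Eq x y => Four (e x = e y) (eq_neg M (e x) (e y))
  | Neg p =>
      let P := eval M e p in
      Four (is_false P) (is_true P)
  | And p q =>
      let P := eval M e p in let Q := eval M e q in
      Four (is_true P /\ is_true Q) (is_false P \/ is_false Q)
  | Or p q =>
      let P := eval M e p in let Q := eval M e q in
      Four (is_true P \/ is_true Q) (is_false P /\ is_false Q)
  | Imp p q =>
      let P := eval M e p in let Q := eval M e q in
      Four (is_true P -> is_true Q) (is_true P /\ is_false Q)
  | Iff p q =>
      let P := eval M e p in let Q := eval M e q in
      Four (is_true P <-> is_true Q)
           ((is_true P /\ is_false Q) \/ (is_false P /\ is_true Q))
  | Bot => Four False True
  | All x p =>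
      Four (forall a : M, is_true (eval M (update e x a) p))
           (exists a : M, is_false (eval M (update e x a) p))
  | Ex x p =>
      Four (exists a : M, is_true (eval M (update e x a) p))
           (forall a : M, is_false (eval M (update e x a) p))
  end.

(** Free variables are read universally, so an axiom with parameters stands for
    its universal closure. *)
Definition holds (M : model) (phi : form) : Prop :=
  forall e : nat -> M, is_true (eval M e phi).

Definition entails (Gamma : form -> Prop) (phi : form) : Prop :=
  forall M : model, (forall gamma, Gamma gamma -> holds M gamma) -> holds M phi.

(** * Writing concrete formulas

    An [expr] yields a formula once it is given an index above all variables
    in scope: a quantifier takes that index [n] as its variable and passes
    [S n] on to its body.  Binders can thus be written as Rocq functions and no
    variable is ever captured. *)

Definition var : Type := nat.
Definition expr : Type := nat -> form.

Declare Scope bs4_scope.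
Delimit Scope bs4_scope with bs4.
Bind Scope bs4_scope with expr.

Definition eIn (x y : var) : expr := fun _ => In x y.
Definition eEq (x y : var) : expr := fun _ => Eq x y.
Definition eNeg (p : expr) : expr := fun n => Neg (p n).
Definition eAnd (p q : expr) : expr := fun n => And (p n) (q n).
Definition eOr (p q : expr) : expr := fun n => Or (p n) (q n).
Definition eImp (p q : expr) : expr := fun n => Imp (p n) (q n).
Definition eIff (p q : expr) : expr := fun n => Iff (p n) (q n).
Definition eBot : expr := fun _ => Bot.
Definition eAll (P : var -> expr) : expr := fun n => All n (P n (S n)).
Definition eEx (P : var -> expr) : expr := fun n => Ex n (P n (S n)).

Definition close (p : expr) : form := p 0.

Notation "x ∈ y" := (eIn x y) (at level 70) : bs4_scope.
Notation "x ≐ y" := (eEq x y) (at level 70) : bs4_scope.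
Notation "∼ p" := (eNeg p) (at level 75, right associativity) : bs4_scope.
Notation "p ∧ q" := (eAnd p q) (at level 80, right associativity) : bs4_scope.
Notation "p ∨ q" := (eOr p q) (at level 85, right associativity) : bs4_scope.
Notation "p → q" := (eImp p q) (at level 90, right associativity) : bs4_scope.
Notation "p ↔ q" := (eIff p q) (at level 95, no associativity) : bs4_scope.
Notation "⊥" := eBot : bs4_scope.
Notation "∀ x .. y , P" := (eAll (fun x => .. (eAll (fun y => P%bs4)) ..))
  (at level 200, x binder, y binder, right associativity) : bs4_scope.
Notation "∃ x .. y , P" := (eEx (fun x => .. (eEx (fun y => P%bs4)) ..))
  (at level 200, x binder, y binder, right associativity) : bs4_scope.

Local Open Scope bs4_scope.

(** Defined connectives: [bang p] is !p and [quest p] is ?p. *)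
Definition eNot (p : expr) : expr := p → ⊥.
Definition bang (p : expr) : expr := ∼ eNot p.
Definition quest (p : expr) : expr := eNot (∼ p).
Definition eCirc (p : expr) : expr := bang p ↔ quest p.
Definition sImp (p q : expr) : expr := (p → q) ∧ (∼ q → ∼ p).
Definition sIff (p q : expr) : expr := (p ↔ q) ∧ (∼ p ↔ ∼ q).
Definition eAmp (p q : expr) : expr := ∼ (p → ∼ q).

Notation "¬ p" := (eNot p) (at level 75, right associativity) : bs4_scope.
Notation "p ⇒ q" := (sImp p q) (at level 90, right associativity) : bs4_scope.
Notation "p ⇔ q" := (sIff p q) (at level 95, no associativity) : bs4_scope.
Notation "p &&& q" := (eAmp p q) (at level 80, right associativity) : bs4_scope.
Notation "[∀ x ∈ A ] P" := (eAll (fun x => eImp (eIn x A) P%bs4))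
  (at level 200, x name, A at level 69, right associativity) : bs4_scope.
Notation "[∃ x ∈ A ] P" := (eEx (fun x => eAmp (eIn x A) P%bs4))
  (at level 200, x name, A at level 69, right associativity) : bs4_scope.

(** * Defined terms

    The language has no function symbols.  A defined term [t] is given by its
    graph: [t y] is a formula that is true iff [y] is the set denoted by [t].
    [LET y := t IN P] is [∃ y (t y & P)].  As [&] only asks whether its left
    argument is true, when [t] denotes exactly one set this formula has the
    truth value (true and false) of [P] at that set. *)

Definition term : Type := var -> expr.

Notation "'LET' y := t 'IN' P" := (eEx (fun y => eAmp (t%bs4 y) P%bs4))
  (at level 200, y name, right associativity) : bs4_scope.

Definition set_of (P : var -> expr) : term := fun A => ∀ x, x ∈ A ⇔ P x.

Notation "⟦ x | P ⟧" := (set_of (fun x => P%bs4))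
  (at level 0, x name, P at level 200) : bs4_scope.

Definition subset (A B : var) : expr := ∀ x, x ∈ A ⇒ x ∈ B.
Definition classical (A : var) : expr := ∀ x, eCirc (x ∈ A).

Definition in_rlm (x A : var) : expr := bang (x ∈ A) ∨ quest (x ∈ A).

Definition pos (A : var) : term := ⟦ x | bang (x ∈ A) ⟧.
Definition pot (A : var) : term := ⟦ x | quest (x ∈ A) ⟧.
Definition both_part (A : var) : term := fun U =>
  LET P := pos A IN LET Q := pot A IN ⟦ x | x ∈ P ∧ ∼ x ∈ Q ⟧ U.
Definition true_part (A : var) : term := fun U =>
  LET P := pos A IN LET Q := pot A IN ⟦ x | x ∈ P ∧ x ∈ Q ⟧ U.
Definition neither_part (A : var) : term := fun U =>
  LET P := pos A IN LET Q := pot A IN ⟦ x | x ∈ Q ∧ ∼ x ∈ P ⟧ U.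
Definition rlm (A : var) : term := fun U =>
  LET P := pos A IN LET Q := pot A IN ⟦ x | x ∈ P ∨ x ∈ Q ⟧ U.

(** ⟨X|Y⟩ *)
Definition angle (X Y : var) : term := fun W => pos W X ∧ pot W Y.

Definition empty : term := ⟦ x | ⊥ ⟧.

(** {x : x = a} need not be a set, since x = a is non-false for a proper class
    of x, so unordered pairs are formed with !(x = a). *)
Definition upair (a b : var) : term := ⟦ x | bang (x ≐ a) ∨ bang (x ≐ b) ⟧.
Definition sing (a : var) : term := upair a a.

(** (a,b) = { {x} : x ∈ a } ∪ { {∅,{y}} : y ∈ b }.  The Kuratowski pair is
    always classical and so satisfies (a,b) = (c,d) ⇔ (a = c ∧ b = d) only as
    far as truth goes.  Here (a,b)^! and (a,b)^? are disjoint unions of copies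
    of a^!, b^! and of a^?, b^? respectively, which gives the equivalence for
    falsity as well. *)
Definition opair (a b : var) : term :=
  ⟦ z | (∃ x, sing x z &&& x ∈ a)
        ∨ (∃ y, (LET o := empty IN LET s := sing y IN upair o s z) &&& y ∈ b) ⟧.
Definition triple (a b c : var) : term := fun t =>
  LET p := opair a b IN opair p c t.

(** (a,b) ∈ f *)
Definition pair_in (a b f : var) : expr := LET p := opair a b IN p ∈ f.

Definition dom (f : var) : term := ⟦ x | ∃ y, pair_in x y f ⟧.
Definition ran (f : var) : term := ⟦ y | ∃ x, pair_in x y f ⟧.

Definition function (f : var) : expr :=
  classical f
  ∧ ([∀ p ∈ f] ∃ a b, opair a b p)
  ∧ (∀ a b c, pair_in a b f ∧ pair_in a c f → bang (b ≐ c)).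
Definition injection (f : var) : expr :=
  function f ∧ (∀ a b c, pair_in a c f ∧ pair_in b c f → bang (a ≐ b)).

(** f[A] = {y : ∃x (y = f(x) & x ∈ A)} *)
Definition image (f A : var) : term := ⟦ y | ∃ x, pair_in x y f &&& x ∈ A ⟧.

(** * Axioms of BZFC *)

(** [fresh phi] is at least 2 and above every variable occurring in [phi]; the
    schemata use 0 and 1 as the distinguished variables of [phi], and all its
    other variables are parameters. *)
Fixpoint fresh (phi : form) : nat :=
  match phi with
  | In x y | Eq x y => Nat.max 2 (Nat.max (S x) (S y))
  | Neg p => fresh p
  | And p q | Or p q | Imp p q | Iff p q => Nat.max (fresh p) (fresh q)
  | Bot => 2
  | All x p | Ex x p => Nat.max (S x) (fresh p)
  end.

Definition eForm (phi : form) : expr := fun _ => phi.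
Definition eAllAt (x : var) (p : expr) : expr := fun n => All x (p n).
Definition eExAt (x : var) (p : expr) : expr := fun n => Ex x (p n).

Definition ax_extensionality : form :=
  close (∀ A B, A ≐ B ⇔ (∀ x, x ∈ A ⇔ x ∈ B)).

(** The variable 0 is the x of phi(x). *)
Definition ax_comprehension (phi : form) : form :=
  (∀ A, ∃ B, eAllAt 0 (0 ∈ B ⇔ 0 ∈ A ∧ eForm phi)) (fresh phi).

Definition ax_classical_superset : form :=
  close (∀ A, ∃ C, classical C ∧ subset A C).

Definition ax_pairing : form :=
  close (∀ a b, ∃ C, a ∈ C ∧ b ∈ C).

Definition ax_union : form :=
  close (∀ A, ∃ B, [∀ y ∈ A] [∀ x ∈ y] x ∈ B).

Definition ax_power : form :=
  close (∀ A, ∃ P, ∀ X, subset X A → X ∈ P).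

Definition ax_infinity : form :=
  close (∃ I, ([∃ o ∈ I] empty o)
              ∧ ([∀ x ∈ I] [∃ s ∈ I] ⟦ z | z ∈ x ∨ bang (z ≐ x) ⟧ s)).

(** The variables 0 and 1 are the x and y of phi(x,y). *)
Definition ax_replacement (phi : form) : form :=
  (∀ A, eAllAt 0 (0 ∈ A → ∃ z, eAllAt 1 (eForm phi → 1 ≐ z))
        → ∃ B, eAllAt 1 (eExAt 0 (0 ∈ A ∧ eForm phi) → 1 ∈ B)) (fresh phi).

(** Well-foundedness concerns membership in the realm: A has a member x such
    that no member of A is in rlm(x). *)
Definition ax_foundation : form :=
  close (∀ A, (∃ x, x ∈ A) → [∃ x ∈ A] [∀ y ∈ A] ¬ in_rlm y x).

Definition ax_choice : form :=
  close (∀ X, classical X ∧ ([∀ u ∈ X] ∃ x, x ∈ u)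
              → ∃ f, function f ∧ dom f X ∧ (∀ u x, pair_in u x f → x ∈ u)).

Definition ax_acla : form :=
  close ((∃ A, LET P := pos A IN LET Q := pot A IN ∼ subset P Q)
         ∧ (∃ A, LET P := pos A IN LET Q := pot A IN ∼ subset Q P)).

Inductive BZFC : form -> Prop :=
| BZFC_extensionality : BZFC ax_extensionality
| BZFC_comprehension : forall phi, BZFC (ax_comprehension phi)
| BZFC_classical_superset : BZFC ax_classical_superset
| BZFC_pairing : BZFC ax_pairing
| BZFC_union : BZFC ax_union
| BZFC_power : BZFC ax_power
| BZFC_infinity : BZFC ax_infinity
| BZFC_replacement : forall phi, BZFC (ax_replacement phi)
| BZFC_foundation : BZFC ax_foundation
| BZFC_choice : BZFC ax_choice
| BZFC_acla : BZFC ax_acla.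

(** * Equinumerosity and cardinal numbers *)

Definition count (A f : var) : expr := injection f ∧ (LET R := rlm A IN dom f R).

Definition equinumerous (A B : var) : expr :=
  ∃ f, count A f &&& (∃ g, count B g &&&
    (LET u := image f A IN LET v := image g B IN u ≐ v)).

(** A transitive classical set with classical elements is hereditarily
    classical, so this is "transitive and strictly well-ordered by ∈" in the
    inner model of hereditarily classical sets. *)
Definition ordinal (a : var) : expr :=
  classical a
  ∧ ([∀ x ∈ a] classical x)
  ∧ ([∀ x ∈ a] [∀ y ∈ x] y ∈ a)
  ∧ ([∀ x ∈ a] ¬ x ∈ x)
  ∧ ([∀ x ∈ a] [∀ y ∈ a] [∀ z ∈ a] x ∈ y ∧ y ∈ z → x ∈ z)
  ∧ ([∀ x ∈ a] [∀ y ∈ a] x ∈ y ∨ x ≐ y ∨ y ∈ x)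
  ∧ (∀ S, classical S ∧ subset S a ∧ (∃ x, x ∈ S)
          → [∃ m ∈ S] [∀ x ∈ S] m ∈ x ∨ m ≐ x).

Definition in_bijection (X Y : var) : expr :=
  ∃ f, injection f ∧ dom f X ∧ ran f Y.

(** |X|_Cl, for classical X *)
Definition card_cl (X : var) : term := fun k =>
  ordinal k ∧ in_bijection X k
  ∧ (∀ b, ordinal b ∧ in_bijection X b → k ∈ b ∨ k ≐ b).

(** |A| *)
Definition card (A : var) : term := fun k =>
  LET A1 := pos A IN LET A2 := pot A IN
  LET At := true_part A IN LET Ab := both_part A IN LET An := neither_part A IN
  LET c1 := card_cl A1 IN LET c2 := card_cl A2 IN
  LET ct := card_cl At IN LET cb := card_cl Ab IN LET cn := card_cl An IN
  LET X := angle c1 c2 IN LET Y := angle ct c2 IN LET Z := angle cb cn IN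
  triple X Y Z k.

(** |A| = |B| *)
Definition card_eq (A B : var) : expr :=
  LET k := card A IN LET l := card B IN k ≐ l.

(* Main.v *)
From Stdlib Require Import Arith Lia Classical.
Require Import Defs.

(** Truth.  A counting [f] of [A] and a counting [g] of [B] with [f[A] = g[B]]
    match the elements of [A] that are only true, both, and only non-false with
    those of [B], and matchings of these three parts give such countings.

    Falsity.  A disequality of the coordinates ⟨a|b⟩ and ⟨c|d⟩ means that
    [a > d] or [c > b].  So |A| ≠ |B| fails iff there are injections of [A^!]
    into [B^?] and of [A_b] into [B_n], and likewise with [A] and [B]
    exchanged.  On the other side, A ≇ B fails iff some countings satisfy
    [f[A^!] ⊆ g[B^?]] and [g[B^!] ⊆ f[A^?]], that is, iff a partial matching of
    [rlm A] with [rlm B] covers [A^!] and [B^!], sends [A^!] into [B^?] and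
    [B^!] into [A^?]; it necessarily sends [A_b] into [B_n] and [B_b] into
    [A_n].  Conversely, the injections of [A^!] and of [A_b] combine into a
    single injection of [A^!] into [B^?] that sends [A_b] into [B_n]
    ([refine_embedding]), and the two one-sided matchings so obtained combine
    as in the Cantor-Bernstein theorem ([common_matching]).

    All of this takes place in an arbitrary model of BZFC, where Comprehension
    and Replacement are available for definable classes only. *)

Notation "x ∈+ A" := (in_pos _ x A) (at level 70, no associativity).
Notation "x ∈- A" := (in_neg _ x A) (at level 70, no associativity).

(** A Rocq predicate on the carrier need not be definable in the model, and the natural numbers of
    the model may be non-standard, so neither an inductive predicate nor iteration along [nat]
    yields a set of the model. Orbits and chains are therefore described by quantifying over all
    sets [W] closed under a step relation, and the recursion behind well-ordering by attempts that
    are themselves sets. Each class turned into a set carries a certificate of definability, which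
    [dfn] finds by following its logical shape.

    The second coordinate of |A| makes truth work for infinite sets: there the sizes of A^!, A^?,
    A_b and A_n do not determine that of A_t, and all three of A_t, A_b, A_n must be matched.

    For falsity, the partner b of an a in A_b cannot lie in B^!, since then a, being the partner of
    b, would lie in A^?. An injection of A^! into B^? taken alone may violate this, hence its
    refinement by the injection of A_b; following chains treats finite and infinite sets alike. *)

Lemma update_eq {M : Type} (e : nat -> M) x a : update e x a x = a.
Proof. unfold update. now rewrite Nat.eqb_refl. Qed.

Lemma update_neq {M : Type} (e : nat -> M) x y a : y <> x -> update e x a y = e y.
Proof. intros H. unfold update. now apply Nat.eqb_neq in H as ->. Qed.

Lemma fresh_ge2 phi : 2 <= fresh phi.
Proof. induction phi; cbn [fresh]; lia. Qed.

(** Allows the variables that a schema places at [fresh phi] and above to be forgotten when an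
    instance is read in the model. *)
Lemma eval_fresh (M : model) phi : forall e1 e2 : nat -> M,
  (forall i, i < fresh phi -> e1 i = e2 i) ->
  (is_true (eval M e1 phi) <-> is_true (eval M e2 phi)) /\
  (is_false (eval M e1 phi) <-> is_false (eval M e2 phi)).
Proof.
  assert (B : forall n x (e1 e2 : nat -> M),
    (forall i, i < Nat.max (S x) n -> e1 i = e2 i) ->
    forall a i, i < n -> update e1 x a i = update e2 x a i).
  { intros n x e1 e2 H a i Hi. destruct (Nat.eq_dec i x) as [->|D].
    - now rewrite !update_eq.
    - rewrite !update_neq by exact D. apply H. lia. }
  induction phi as [x y|x y|p IH|p IHp q IHq|p IHp q IHq|p IHp q IHq|p IHp q IHq| |x p IH|x p IH];
    cbn [fresh eval is_true is_false]; intros e1 e2 H.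
  1,2: rewrite (H x), (H y) by lia; tauto.
  1: destruct (IH e1 e2 H); tauto.
  1-4: destruct (IHp e1 e2) as [? ?]; [intros; apply H; lia|];
       destruct (IHq e1 e2) as [? ?]; [intros; apply H; lia|]; tauto.
  - tauto.
  - assert (K := fun a => IH _ _ (B _ _ _ _ H a)). split; split.
    1,2: intros T a; apply K, T.
    1,2: intros [a T]; exists a; apply K, T.
  - assert (K := fun a => IH _ _ (B _ _ _ _ H a)). split; split.
    1,2: intros [a T]; exists a; apply K, T.
    1,2: intros T a; apply K, T.
Qed.

(** * Definable classes *)

(** De Bruijn formulas with constants [C c] and two-valued atoms
    (truth, non-falsity). *)
Inductive dterm : Type := V (i : nat) | C (c : nat).
Inductive dform : Type :=
| DIn : dterm -> dterm -> dform
| DPot : dterm -> dterm -> dform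
| DEq : dterm -> dterm -> dform
| DImp : dform -> dform -> dform
| DBot : dform
| DAll : dform -> dform.

Definition scons {T : Type} (a : T) (e : nat -> T) (i : nat) : T :=
  match i with 0 => a | S j => e j end.

Definition dterm_val {M : Type} (r e : nat -> M) (t : dterm) : M :=
  match t with V i => e i | C c => r c end.

Fixpoint dval (M : model) (r e : nat -> M) (d : dform) : Prop :=
  match d with
  | DIn s t => dterm_val r e s ∈+ dterm_val r e t
  | DPot s t => ~ dterm_val r e s ∈- dterm_val r e t
  | DEq s t => dterm_val r e s = dterm_val r e t
  | DImp p q => dval M r e p -> dval M r e q
  | DBot => False
  | DAll p => forall a, dval M r (scons a e) p
  end.

(** The variables 0 and 1 are left to the schemata, so the constant [c]
    becomes the variable [2 + c]. *)
Definition to_var (v : nat -> nat) (t : dterm) : nat :=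
  match t with V i => v i | C c => 2 + c end.

(** Atoms become !(s ∈ t), ?(s ∈ t) and !(s = t), so the result is two-valued: false exactly when
    not true. The variable [n] lies above all those in use and is taken by the next quantifier; [v]
    assigns variables to the de Bruijn indices. *)
Fixpoint to_form (v : nat -> nat) (n : nat) (d : dform) : form :=
  match d with
  | DIn s t => Neg (Imp (In (to_var v s) (to_var v t)) Bot)
  | DPot s t => Imp (Neg (In (to_var v s) (to_var v t))) Bot
  | DEq s t => Neg (Imp (Eq (to_var v s) (to_var v t)) Bot)
  | DImp p q => Imp (to_form v n p) (to_form v n q)
  | DBot => Bot
  | DAll p => All n (to_form (scons n v) (S n) p)
  end.

Definition dterm_bound (t : dterm) : nat :=
  match t with V _ => 0 | C c => S c end.

Fixpoint const_bound (d : dform) : nat :=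
  match d with
  | DIn s t | DPot s t | DEq s t => Nat.max (dterm_bound s) (dterm_bound t)
  | DImp p q => Nat.max (const_bound p) (const_bound q)
  | DBot => 0
  | DAll p => const_bound p
  end.

Lemma to_form_val (M : model) d : forall v n (e r y : nat -> M),
  (forall i, v i < n) -> 2 + const_bound d <= n ->
  (forall c, c < const_bound d -> r c = e (2 + c)) ->
  (forall i, y i = e (v i)) ->
  (is_true (eval M e (to_form v n d)) <-> dval M r y d) /\
  (is_false (eval M e (to_form v n d)) <-> ~ dval M r y d).
Proof.
  assert (T : forall v (e r y : nat -> M) t,
    (forall c, c < dterm_bound t -> r c = e (2 + c)) ->
    (forall i, y i = e (v i)) -> dterm_val r y t = e (to_var v t)).
  { intros v e r y [i|c] H1 H2; simpl; [apply H2|apply H1; simpl; lia]. }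
  induction d as [s t|s t|s t|p IHp q IHq| |p IH]; intros v n e r y Hv Hn Hr Hy;
    cbn [const_bound] in *; cbn [to_form eval is_true is_false dval].
  1-3: rewrite (T v e r y s), (T v e r y t) by (auto; intros; apply Hr; lia); tauto.
  - destruct (IHp v n e r y) as [? ?]; auto; [lia|intros; apply Hr; lia|].
    destruct (IHq v n e r y) as [? ?]; auto; [lia|intros; apply Hr; lia|]. tauto.
  - tauto.
  - assert (K : forall a,
      (is_true (eval M (update e n a) (to_form (scons n v) (S n) p))
         <-> dval M r (scons a y) p) /\
      (is_false (eval M (update e n a) (to_form (scons n v) (S n) p))
         <-> ~ dval M r (scons a y) p)).
    { intros a. apply IH.
      - intros [|i]; simpl; [lia|]. specialize (Hv i). lia.
      - lia.
      - intros c Hc. rewrite update_neq by lia. now apply Hr.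
      - intros [|i]; cbn [scons].
        + now rewrite update_eq.
        + rewrite update_neq by (specialize (Hv i); lia). apply Hy. }
    split; split.
    + intros H a. apply K, H.
    + intros H a. apply K, H.
    + intros [a H] H'. apply K in H. auto.
    + intros H. apply not_all_ex_not in H as [a H]. exists a. now apply K.
Qed.

Fixpoint rename_consts (f : nat -> nat) (d : dform) : dform :=
  let g t := match t with V i => V i | C c => C (f c) end in
  match d with
  | DIn s t => DIn (g s) (g t)
  | DPot s t => DPot (g s) (g t)
  | DEq s t => DEq (g s) (g t)
  | DImp p q => DImp (rename_consts f p) (rename_consts f q)
  | DBot => DBot
  | DAll p => DAll (rename_consts f p)
  end.

Lemma dval_rename (M : model) d f (r r' : nat -> M) :
  (forall c, r' (f c) = r c) ->
  forall e, dval M r' e (rename_consts f d) <-> dval M r e d.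
Proof.
  intros H. induction d as [s t|s t|s t|p IHp q IHq| |p IH]; intros e; simpl.
  1-3: destruct s, t; simpl; rewrite ?H; tauto.
  - rewrite IHp, IHq. tauto.
  - tauto.
  - split; intros K a; apply IH, K.
Qed.

(** Stated for classes of whole environments, so that it passes under quantifiers; the table [r]
    holds the parameters from the model. *)
Definition definable {M : model} (P : (nat -> M) -> Prop) : Prop :=
  exists d (r : nat -> M), forall e, dval M r e d <-> P e.

Definition def_term {M : model} (t : (nat -> M) -> M) : Prop :=
  exists (s : dterm) a, forall e, t e = dterm_val (fun _ => a) e s.

Section Definability.
Context {M : model}.
Implicit Types (P Q : (nat -> M) -> Prop) (s t : (nat -> M) -> M).

Lemma definable_iff P Q : (forall e, P e <-> Q e) -> definable P -> definable Q.
Proof. intros H (d & r & Hd). exists d, r. intros e. now rewrite Hd. Qed.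

Lemma definable_bin P Q (F : Prop -> Prop -> Prop) (mk : dform -> dform -> dform) :
  (forall r e p q, dval M r e (mk p q) <-> F (dval M r e p) (dval M r e q)) ->
  (forall A A' B B', (A <-> A') -> (B <-> B') -> (F A B <-> F A' B')) ->
  definable P -> definable Q -> definable (fun e => F (P e) (Q e)).
Proof.
  intros Hmk HF (d & r & Hd) (d' & r' & Hd').
  (* The two formulas come with separate tables of parameters. They are interleaved, [r] at the even
     and [r'] at the odd indices, to give one table for the compound formula. *)
  set (r2 := fun n => if Nat.even n then r (Nat.div2 n) else r' (Nat.div2 n)).
  exists (mk (rename_consts (fun c => 2 * c) d) (rename_consts (fun c => S (2 * c)) d')), r2.
  intros e. rewrite Hmk. apply HF.
  - rewrite (dval_rename M d _ r), Hd; [tauto|]. intros c. unfold r2.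
    rewrite Nat.div2_double, Nat.even_even. reflexivity.
  - rewrite (dval_rename M d' _ r'), Hd'; [tauto|]. intros c. unfold r2.
    rewrite Nat.div2_succ_double. replace (S (2 * c)) with (2 * c + 1) by lia.
    now rewrite Nat.even_odd.
Qed.

Lemma definable_imp P Q :
  definable P -> definable Q -> definable (fun e => P e -> Q e).
Proof. apply (definable_bin P Q (fun A B => A -> B) DImp); simpl; tauto. Qed.

Lemma definable_const (A : Prop) : @definable M (fun _ => A).
Proof.
  destruct (inhab M) as [a].
  destruct (classic A); [exists (DImp DBot DBot)|exists DBot]; exists (fun _ => a); simpl; tauto.
Qed.

Lemma definable_not P : definable P -> definable (fun e => ~ P e).
Proof. intros H. apply (definable_imp P (fun _ => False)); auto using definable_const. Qed.

Lemma definable_and P Q :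
  definable P -> definable Q -> definable (fun e => P e /\ Q e).
Proof.
  intros HP HQ. apply (definable_iff (fun e => ~ (P e -> ~ Q e))).
  - intros e. tauto.
  - auto using definable_not, definable_imp.
Qed.

Lemma definable_or P Q :
  definable P -> definable Q -> definable (fun e => P e \/ Q e).
Proof.
  intros HP HQ. apply (definable_iff (fun e => ~ P e -> Q e)).
  - intros e. tauto.
  - auto using definable_not, definable_imp.
Qed.

Lemma definable_equiv P Q :
  definable P -> definable Q -> definable (fun e => P e <-> Q e).
Proof. intros HP HQ. apply definable_and; auto using definable_imp. Qed.

Lemma definable_all (P : M -> (nat -> M) -> Prop) :
  definable (fun e => P (e 0) (fun i => e (S i))) ->
  definable (fun e => forall a, P a e).
Proof.
  intros (d & r & H). exists (DAll d), r. intros e. simpl.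
  split; intros K a; apply (H (scons a e)), K.
Qed.

Lemma definable_ex (P : M -> (nat -> M) -> Prop) :
  definable (fun e => P (e 0) (fun i => e (S i))) ->
  definable (fun e => exists a, P a e).
Proof.
  intros H. apply (definable_iff (fun e => ~ forall a, ~ P a e)).
  - intros e. split; [apply not_all_not_ex|intros [a Ha] K; exact (K a Ha)].
  - apply definable_not, (definable_all (fun a e => ~ P a e)), definable_not, H.
Qed.

Lemma definable_atom s t (F : M -> M -> Prop) (mk : dterm -> dterm -> dform) :
  (forall r e u w, dval M r e (mk u w) <-> F (dterm_val r e u) (dterm_val r e w)) ->
  def_term s -> def_term t -> definable (fun e => F (s e) (t e)).
Proof.
  intros Hmk (u & a & Hs) (w & b & Ht).
  (* Constant 0 is reserved for the first term and constant 1 for the second, so that one table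
     holds the parameters of both. *)
  set (g := fun c x => match x with V i => V i | C _ => C c end).
  exists (mk (g 0 u) (g 1 w)), (scons a (fun _ => b)). intros e.
  rewrite Hmk, Hs, Ht. destruct u, w; simpl; tauto.
Qed.

Lemma definable_in s t : def_term s -> def_term t -> definable (fun e => s e ∈+ t e).
Proof. apply (definable_atom s t (fun a b => a ∈+ b) DIn). simpl. tauto. Qed.

Lemma definable_eq s t : def_term s -> def_term t -> definable (fun e => s e = t e).
Proof. apply (definable_atom s t eq DEq). simpl. tauto. Qed.

Lemma definable_notin s t : def_term s -> def_term t -> definable (fun e => s e ∈- t e).
Proof.
  intros Hs Ht. apply (definable_iff (fun e => ~ ~ s e ∈- t e)); [intros; tauto|].
  apply definable_not.
  apply (definable_atom s t (fun a b => ~ a ∈- b) DPot); auto. simpl. tauto.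
Qed.

Lemma def_term_var i : @def_term M (fun e => e i).
Proof. destruct (inhab M) as [a]. now exists (V i), a. Qed.

Lemma def_term_const (a : M) : def_term (fun _ => a).
Proof. now exists (C 0), a. Qed.

Lemma def_term_shift k t : def_term t -> def_term (fun e => t (fun i => e (k + i))).
Proof.
  intros ([i|c] & a & H).
  - exists (V (k + i)), a. intros e. now rewrite H.
  - exists (C c), a. intros e. now rewrite H.
Qed.

End Definability.

(** Quantifying over the argument term builds substitution in: a hypothesis of this form can be used
    beneath any quantifiers. *)
Definition definable1 {M : model} (P : M -> Prop) : Prop :=
  forall s, def_term s -> definable (fun e => P (s e)).

Definition definable2 {M : model} (R : M -> M -> Prop) : Prop :=
  forall s t, def_term s -> def_term t -> definable (fun e => R (s e) (t e)).

Ltac def_tm := cbv beta; first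
  [ assumption | apply def_term_var | apply def_term_const
  | match goal with H : def_term ?t |- _ => first
      [ exact (def_term_shift 1 t H) | exact (def_term_shift 2 t H)
      | exact (def_term_shift 3 t H) | exact (def_term_shift 4 t H)
      | exact (def_term_shift 5 t H) | exact (def_term_shift 6 t H) ] end ].

(** A hook, redefined once the definability of pairs is established, so that [dfn] can treat the
    ternary pair notions as atoms. *)
Ltac def_notion := fail.

Ltac dfn := intros; cbv beta; first
  [ apply definable_const
  | apply definable_in; def_tm
  | apply definable_notin; def_tm
  | apply definable_eq; def_tm
  | match goal with H : definable1 ?P |- _ => apply (H _); def_tm end
  | match goal with H : definable2 ?R |- _ => apply (H _ _); def_tm end
  | def_notion; def_tm
  | apply definable_and; dfn
  | apply definable_or; dfn
  | apply definable_not; dfn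
  | apply definable_equiv; dfn
  | apply definable_imp; dfn
  | apply definable_ex; dfn
  | apply definable_all; dfn ].

Ltac upd := repeat (rewrite update_eq in * || rewrite update_neq in * by lia).

Class bzfc_model (M : model) : Prop :=
  bzfc_holds : forall gamma, BZFC gamma -> holds M gamma.

(** * Set existence in a model of BZFC *)

Section Model.
Context {M : model} {HM : bzfc_model M}.
Implicit Types (A B X Y a b x y z : carrier M).

(** [is_foo] is the truth condition of the formula [foo], spelled out so that
    it is convertible with its evaluation; [is_set_of T F] has both the truth
    and the falsity condition of the defining formula as arguments. *)
Definition is_set_of (T F : M -> Prop) A : Prop :=
  forall x, (x ∈+ A <-> T x) /\ (x ∈- A <-> F x).

Definition is_classical A : Prop := forall x, (x ∈+ A /\ True) <-> (x ∈- A -> False).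

Definition is_pos A : M -> Prop := is_set_of (fun x => x ∈+ A /\ True) (fun x => x ∈+ A -> False).
Definition is_pot A : M -> Prop := is_set_of (fun x => x ∈- A -> False) (fun x => x ∈- A /\ True).
Definition is_both_part A U : Prop := exists P, is_pos A P /\ exists Q, is_pot A Q /\
  is_set_of (fun x => x ∈+ P /\ x ∈- Q) (fun x => x ∈- P \/ x ∈+ Q) U.
Definition is_true_part A U : Prop := exists P, is_pos A P /\ exists Q, is_pot A Q /\
  is_set_of (fun x => x ∈+ P /\ x ∈+ Q) (fun x => x ∈- P \/ x ∈- Q) U.
Definition is_neither_part A U : Prop := exists P, is_pos A P /\ exists Q, is_pot A Q /\
  is_set_of (fun x => x ∈+ Q /\ x ∈- P) (fun x => x ∈- Q \/ x ∈+ P) U.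
Definition is_rlm A U : Prop := exists P, is_pos A P /\ exists Q, is_pot A Q /\
  is_set_of (fun x => x ∈+ P \/ x ∈+ Q) (fun x => x ∈- P /\ x ∈- Q) U.
Definition is_angle X Y W : Prop := is_pos W X /\ is_pot W Y.

Definition is_empty : M -> Prop := is_set_of (fun _ => False) (fun _ => True).
Definition is_upair a b : M -> Prop :=
  is_set_of (fun x => (x = a /\ True) \/ (x = b /\ True))
         (fun x => (x = a -> False) /\ (x = b -> False)).
Definition is_sing a : M -> Prop := is_upair a a.
Definition is_tag y z : Prop :=
  exists o, is_empty o /\ exists s, is_sing y s /\ is_upair o s z.
Definition is_opair a b : M -> Prop :=
  is_set_of (fun z => (exists x, is_sing x z /\ x ∈+ a) \/ (exists y, is_tag y z /\ y ∈+ b))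
         (fun z => (forall x, is_sing x z -> x ∈- a) /\ (forall y, is_tag y z -> y ∈- b)).
Definition is_triple a b c t : Prop := exists p, is_opair a b p /\ is_opair p c t.
Definition pair_mem a b f : Prop := exists p, is_opair a b p /\ p ∈+ f.
Definition pair_nonmem a b f : Prop := forall p, is_opair a b p -> p ∈- f.

Definition is_dom f : M -> Prop :=
  is_set_of (fun x => exists y, pair_mem x y f) (fun x => forall y, pair_nonmem x y f).
Definition is_ran f : M -> Prop :=
  is_set_of (fun y => exists x, pair_mem x y f) (fun y => forall x, pair_nonmem x y f).
Definition is_function f : Prop :=
  is_classical f /\ (forall p, p ∈+ f -> exists a b, is_opair a b p) /\
  forall a b c, pair_mem a b f /\ pair_mem a c f -> b = c /\ True.
Definition is_injection f : Prop :=
  is_function f /\ forall a b c, pair_mem a c f /\ pair_mem b c f -> a = b /\ True.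
Definition is_image f A : M -> Prop :=
  is_set_of (fun y => exists x, pair_mem x y f /\ x ∈+ A)
         (fun y => forall x, pair_mem x y f -> x ∈- A).

Definition is_count A f : Prop := is_injection f /\ exists R, is_rlm A R /\ is_dom f R.

Definition is_ordinal a : Prop :=
  is_classical a /\ (forall x, x ∈+ a -> is_classical x) /\
  (forall x, x ∈+ a -> forall y, y ∈+ x -> y ∈+ a) /\
  (forall x, x ∈+ a -> x ∈+ x -> False) /\
  (forall x, x ∈+ a -> forall y, y ∈+ a -> forall z, z ∈+ a -> x ∈+ y /\ y ∈+ z -> x ∈+ z) /\
  (forall x, x ∈+ a -> forall y, y ∈+ a -> x ∈+ y \/ x = y \/ y ∈+ x) /\
  (forall S, is_classical S /\ (forall x, (x ∈+ S -> x ∈+ a) /\ (x ∈- a -> x ∈- S)) /\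
      (exists x, x ∈+ S) ->
    exists m, m ∈+ S /\ forall x, x ∈+ S -> m ∈+ x \/ m = x).

Definition is_bijective X Y : Prop := exists f, is_injection f /\ is_dom f X /\ is_ran f Y.
Definition is_card_cl X k : Prop :=
  is_ordinal k /\ is_bijective X k /\
  forall b, is_ordinal b /\ is_bijective X b -> k ∈+ b \/ k = b.

Definition is_card A k : Prop :=
  exists A1, is_pos A A1 /\ exists A2, is_pot A A2 /\
  exists At, is_true_part A At /\ exists Ab, is_both_part A Ab /\
  exists An, is_neither_part A An /\
  exists c1, is_card_cl A1 c1 /\ exists c2, is_card_cl A2 c2 /\
  exists ct, is_card_cl At ct /\ exists cb, is_card_cl Ab cb /\
  exists cn, is_card_cl An cn /\
  exists X, is_angle c1 c2 X /\ exists Y, is_angle ct c2 Y /\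
  exists Z, is_angle cb cn Z /\ is_triple X Y Z k.

(** Holds by conversion; the first equivalence is the truth condition and the second the falsity
    condition. As & asks only whether its left argument is true, each [LET] and each bounded ∃ turns
    into an implication on the falsity side. *)
Lemma theorem_reduction :
  (forall A B,
    ((exists k, is_card A k /\ exists l, is_card B l /\ k = l) <->
     (exists f, is_count A f /\ exists g, is_count B g /\
       exists u, is_image f A u /\ exists v, is_image g B v /\ u = v)) /\
    ((forall k, is_card A k -> forall l, is_card B l -> eq_neg M k l) <->
     (forall f, is_count A f -> forall g, is_count B g ->
       forall u, is_image f A u -> forall v, is_image g B v -> eq_neg M u v))) ->
  holds M (close (∀ (A B : var), card_eq A B ⇔ equinumerous A B)%bs4).
Proof. intros H e A B. exact (H A B). Qed.

(** * The axioms read as statements about the model *)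

Definition cls A := forall x, x ∈+ A <-> ~ x ∈- A.

Definition collects B (P : M -> Prop) : Prop :=
  forall x, (x ∈+ B <-> P x) /\ (x ∈- B <-> ~ P x).

Lemma axiom_true gamma : BZFC gamma -> exists e : nat -> M, is_true (eval M e gamma).
Proof. intros H. destruct (inhab M) as [a]. exists (fun _ => a). now apply bzfc_holds. Qed.

Lemma set_eq A B :
  (forall x, (x ∈+ A <-> x ∈+ B) /\ (x ∈- A <-> x ∈- B)) -> A = B.
Proof.
  destruct (axiom_true _ BZFC_extensionality) as [e H].
  intros K. apply (H A B). intros x. apply K.
Qed.

Lemma eq_neg_iff A B :
  eq_neg M A B <-> exists x, (x ∈+ A /\ x ∈- B) \/ (x ∈- A /\ x ∈+ B).
Proof.
  destruct (axiom_true _ BZFC_extensionality) as [e H].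
  destruct (H A B) as [_ K]. cbn in K. rewrite K.
  split; intros [x Hx]; exists x; tauto.
Qed.

Lemma cls_eq A B : cls A -> cls B -> (forall x, x ∈+ A <-> x ∈+ B) -> A = B.
Proof.
  intros HA HB H. apply set_eq. intros x. split; [apply H|].
  specialize (HA x). specialize (HB x). specialize (H x). tauto.
Qed.

Lemma collects_cls B P : collects B P -> cls B.
Proof. intros H x. destruct (H x). tauto. Qed.

Lemma collects_in B P x : collects B P -> (x ∈+ B <-> P x).
Proof. intros H. apply H. Qed.

Lemma cls_collects B (P : M -> Prop) : cls B -> (forall x, x ∈+ B <-> P x) -> collects B P.
Proof. intros H K x. specialize (H x). specialize (K x). tauto. Qed.

Lemma collects_unique A B P Q :
  collects A P -> collects B Q -> (forall x, P x <-> Q x) -> A = B.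
Proof.
  intros HA HB H. apply set_eq. intros x.
  destruct (HA x), (HB x). specialize (H x). tauto.
Qed.

Definition bounded (P : M -> Prop) : Prop := exists A, forall x, P x -> x ∈+ A.

(** The truth half of [subset A C] covers A^!; its falsity half, contraposed, covers A^?. *)
Lemma superset A : exists C, cls C /\
  (forall x, x ∈+ A -> x ∈+ C) /\ (forall x, ~ x ∈- A -> x ∈+ C).
Proof.
  destruct (axiom_true _ BZFC_classical_superset) as [e H].
  destruct (H A) as (C & HC & HS). cbn in HC, HS. exists C.
  assert (K : cls C) by (intros x; specialize (HC x); tauto).
  split; [exact K|split].
  - intros x. apply HS.
  - intros x Hx. apply K. intros Hn. apply Hx, HS, Hn.
Qed.

Lemma comprehension phi (e : nat -> M) A : exists B, forall x,
  (x ∈+ B <-> x ∈+ A /\ is_true (eval M (update e 0 x) phi)) /\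
  (x ∈- B <-> x ∈- A \/ is_false (eval M (update e 0 x) phi)).
Proof.
  pose proof (bzfc_holds _ (BZFC_comprehension phi) e A) as [B H]. exists B. intros x.
  specialize (H x). cbn [eIn eAnd eForm sIff eIff eNeg eval is_true is_false] in H.
  pose proof (fresh_ge2 phi) as F.
  rewrite update_eq in H.
  rewrite (update_neq _ 0 (S (fresh phi))), update_eq,
    (update_neq _ 0 (fresh phi)), (update_neq _ (S (fresh phi)) (fresh phi)),
    update_eq in H by lia.
  destruct (eval_fresh M phi
    (update (update (update e (fresh phi) A) (S (fresh phi)) B) 0 x) (update e 0 x))
    as [K1 K2]; [|tauto].
  intros i Hi. destruct (Nat.eq_dec i 0) as [->|D]; [now rewrite !update_eq|].
  now rewrite !update_neq by lia.
Qed.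

(** [e0] supplies the parameters of the class [P]. *)
Lemma definable_form (P : (nat -> M) -> Prop) (v : nat -> nat) :
  (forall i, v i < 2) -> definable P ->
  exists phi (e0 : nat -> M), forall e, (forall i, 2 <= i -> e i = e0 i) ->
  (is_true (eval M e phi) <-> P (fun i => e (v i))) /\
  (is_false (eval M e phi) <-> ~ P (fun i => e (v i))).
Proof.
  intros Hv (d & r & Hd). exists (to_form v (2 + const_bound d) d).
  exists (fun i => r (i - 2)). intros e He.
  rewrite <- Hd. apply to_form_val; auto.
  - intros i. specialize (Hv i). lia.
  - intros c _. rewrite He by lia. f_equal. lia.
Qed.

Lemma collect (P : M -> Prop) : definable1 P -> bounded P -> exists B, collects B P.
Proof.
  intros D [A HA]. destruct (superset A) as (C & HC & HS & _).
  destruct (definable_form (fun e => P (e 0)) (fun _ => 0)) as (phi & e & H);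
    [lia|apply (D (fun e => e 0)), def_term_var|].
  destruct (comprehension phi e C) as [B HB]. exists B. intros x.
  destruct (HB x) as [-> ->]. destruct (H (update e 0 x)) as [-> ->].
  - intros i Hi. apply update_neq. lia.
  - rewrite update_eq. specialize (HA x). specialize (HS x). specialize (HC x). tauto.
Qed.

Lemma replacement (R : M -> M -> Prop) A : definable2 R ->
  (forall x y z, x ∈+ A -> R x y -> R x z -> y = z) ->
  exists B, collects B (fun y => exists x, x ∈+ A /\ R x y).
Proof.
  intros D HR. apply collect; [red; dfn|].
  destruct (definable_form (fun e => R (e 0) (e 1)) (fun i => match i with 0 => 0 | _ => 1 end))
    as (phi & e & H); [intros []; lia|apply (D (fun e => e 0) (fun e => e 1)); apply def_term_var|].
  pose proof (bzfc_holds _ (BZFC_replacement phi) e A) as K.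
  cbn [eIn eImp eEx eForm eAllAt eExAt eAnd eEq eval is_true is_false] in K.
  pose proof (fresh_ge2 phi) as F. set (N := fresh phi) in *.
  (* [phi] is known to express [R] in environments that agree with [e] from 2 on. By [eval_fresh]
     only the indices below [N] matter, which tolerates the set variables that the axiom puts at [N]
     and [S N]. *)
  assert (U : forall e' : nat -> M, (forall i, 2 <= i < N -> e' i = e i) ->
    (is_true (eval M e' phi) <-> R (e' 0) (e' 1))).
  { intros e' He. destruct (H (scons (e' 0) (scons (e' 1) (fun i => e (2 + i))))) as [E _].
    - intros [|[|i]] Hi; simpl; auto; lia.
    - cbn [scons] in E. rewrite <- E. apply eval_fresh. intros [|[|i]] Hi; simpl; auto. apply He. unfold N. lia. }
  destruct K as [B HB].
  - intros x Hx. upd.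
    assert (V : forall z y, is_true (eval M (update (update (update (update e N A) 0 x) (S N) z) 1 y) phi) -> R x y).
    { intros z y Hy. apply U in Hy; upd; [exact Hy|]. intros i Hi. now upd. }
    destruct (classic (exists z, R x z)) as [[z Hz]|HN].
    + exists z. intros y Hy. apply V in Hy. cbn [eEq eval is_true]. upd. eauto.
    (* Where [x] has no image the axiom still asks for some [z]; [A] is an arbitrary default. *)
    + exists A. intros y Hy. apply V in Hy. exfalso. eauto.
  - exists B. intros y (x & Hx & HR'). specialize (HB y). upd. apply HB.
    exists x. upd. split; [exact Hx|]. apply U; upd; [|exact HR'].
    intros i Hi. now upd.
Qed.

Lemma union_bound A : exists B, forall x y, y ∈+ A -> x ∈+ y -> x ∈+ B.
Proof.
  destruct (axiom_true _ BZFC_union) as [e H]. destruct (H A) as [B HB].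
  exists B. intros x y Hy Hx. exact (HB y Hy x Hx).
Qed.

Lemma pair_bound a b : exists C, a ∈+ C /\ b ∈+ C.
Proof. destruct (axiom_true _ BZFC_pairing) as [e H]. exact (H a b). Qed.

Lemma bounded_sub (P Q : M -> Prop) : (forall x, P x -> Q x) -> bounded Q -> bounded P.
Proof. intros H [A HA]. exists A. auto. Qed.

Lemma bounded_in A : bounded (fun x => x ∈+ A).
Proof. now exists A. Qed.

Lemma bounded_pot A : bounded (fun x => ~ x ∈- A).
Proof. destruct (superset A) as (C & _ & _ & H). now exists C. Qed.

Lemma bounded_or (P Q : M -> Prop) :
  bounded P -> bounded Q -> bounded (fun x => P x \/ Q x).
Proof.
  intros [A HA] [B HB]. destruct (pair_bound A B) as (C & H1 & H2).
  destruct (union_bound C) as [D HD]. exists D. intros x [H|H]; eauto.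
Qed.

Lemma bounded_eq a : bounded (fun x => x = a).
Proof. destruct (pair_bound a a) as (C & H & _). exists C. now intros x ->. Qed.

Lemma power_bound A : cls A ->
  bounded (fun X => cls X /\ forall x, x ∈+ X -> x ∈+ A).
Proof.
  intros HA. destruct (axiom_true _ BZFC_power) as [e H]. destruct (H A) as [P HP].
  exists P. intros X [HX HS]. apply (HP X). intros x. cbn.
  split; [apply HS|]. specialize (HA x). specialize (HX x). specialize (HS x). tauto.
Qed.

(** The existence of a value that is both true and false and of one that is
    neither lets ⟨X|Y⟩ be formed by Comprehension. *)
Lemma angle_ex (P Q : M -> Prop) : definable1 P -> definable1 Q ->
  bounded P -> bounded Q ->
  exists W, forall x, (x ∈+ W <-> P x) /\ (x ∈- W <-> ~ Q x).
Proof.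
  intros DP DQ BP BQ.
  destruct (collect P DP BP) as [X HX]. destruct (collect Q DQ BQ) as [Y HY].
  destruct (bounded_or P Q BP BQ) as [C0 HC0]. destruct (superset C0) as (C & HC & HS & _).
  destruct (axiom_true _ BZFC_acla) as [e [(a & A1 & Ha1 & A2 & Ha2 & s & Hs) (b & B1 & Hb1 & B2 & Hb2 & t & Ht)]].
  cbn in Ha1, Ha2, Hb1, Hb2, Hs, Ht.
  assert (Ha : s ∈+ a /\ s ∈- a).
  { specialize (Ha1 s). specialize (Ha2 s). tauto. }
  assert (Hb : ~ t ∈+ b /\ ~ t ∈- b).
  { specialize (Hb1 t). specialize (Hb2 t). tauto. }
  (* Here [s] ∈ [a] is both true and false, call it g, and [t] ∈ [b] is neither, call it n. With
     variables 2 to 7 standing for [X], [Y], [s], [a], [t], [b], the formula is (P ∧ Q) ∨ (P ∧ g) ∨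
     (Q ∧ n), which is true iff P holds and false iff Q fails. *)
  destruct (comprehension
    (Or (And (In 0 2) (In 0 3)) (Or (And (In 0 2) (In 4 5)) (And (In 0 3) (In 6 7))))
    (scons a (scons a (scons X (scons Y (scons s (scons a (scons t (fun _ => b)))))))) C) as [W HW].
  exists W. intros x. destruct (HW x) as [-> ->]. cbn.
  destruct (HX x) as [-> ->]. destruct (HY x) as [-> ->].
  assert (P x \/ Q x -> x ∈+ C) by auto.
  assert (x ∈- C -> ~ (P x \/ Q x)) by (intros ? ?; now apply (HC x); auto).
  destruct Ha, Hb. clear - H H0 H1 H2 H3 H4.
  destruct (classic (P x)) as [p|p], (classic (Q x)) as [q|q]; split; tauto.
Qed.

Lemma choice X : cls X -> (forall u, u ∈+ X -> exists x, x ∈+ u) ->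
  exists f, is_function f /\ is_dom f X /\ forall u x, pair_mem u x f -> x ∈+ u.
Proof.
  intros HX HN. destruct (axiom_true _ BZFC_choice) as [e H]. refine (H X _).
  split; [|exact HN]. intros x. specialize (HX x). cbn. tauto.
Qed.

End Model.

(** * Ordered pairs *)

Section Pairs.
Context {M : model} {HM : bzfc_model M}.
Implicit Types (A B X Y a b c d x y z p q f : carrier M).

Lemma is_set_of_iff (T F P : M -> Prop) A :
  (forall x, T x <-> P x) -> (forall x, F x <-> ~ P x) ->
  is_set_of T F A <-> collects A P.
Proof.
  intros HT HF. split; intros H x; specialize (H x); specialize (HT x); specialize (HF x); tauto.
Qed.

Lemma is_pos_iff A U : is_pos A U <-> collects U (fun x => x ∈+ A).
Proof. apply is_set_of_iff; intros; tauto. Qed.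

Lemma is_pot_iff A U : is_pot A U <-> collects U (fun x => ~ x ∈- A).
Proof. apply is_set_of_iff; intros; tauto. Qed.

Lemma is_empty_iff z : is_empty z <-> collects z (fun _ => False).
Proof. apply is_set_of_iff; intros; tauto. Qed.

Lemma is_upair_iff a b z : is_upair a b z <-> collects z (fun x => x = a \/ x = b).
Proof. apply is_set_of_iff; intros; tauto. Qed.

Lemma is_sing_iff a z : is_sing a z <-> collects z (fun x => x = a).
Proof. apply is_set_of_iff; intros; tauto. Qed.

Lemma upair_ex a b : exists z, is_upair a b z.
Proof.
  destruct (collect (fun x => x = a \/ x = b)) as [z Hz].
  - red. dfn.
  - apply bounded_or; apply bounded_eq.
  - exists z. now apply is_upair_iff.
Qed.

Lemma empty_ex : exists z, is_empty z.
Proof.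
  destruct (inhab M) as [a]. destruct (collect (fun _ : M => False)) as [z Hz].
  - red. dfn.
  - now exists a.
  - exists z. now apply is_empty_iff.
Qed.

Lemma sing_unique a z z' : is_sing a z -> is_sing a z' -> z = z'.
Proof. rewrite !is_sing_iff. intros H H'. now apply (collects_unique _ _ _ _ H H'). Qed.

Lemma sing_inj a b z : is_sing a z -> is_sing b z -> a = b.
Proof. rewrite !is_sing_iff. intros H H'. apply (proj1 (H' a)), (proj1 (H a)). reflexivity. Qed.

Lemma tag_ex y : exists z, is_tag y z.
Proof.
  destruct empty_ex as [o Ho]. destruct (upair_ex y y) as [s Hs].
  destruct (upair_ex o s) as [z Hz]. exists z, o. split; [exact Ho|]. now exists s.
Qed.

Lemma tag_unique y z z' : is_tag y z -> is_tag y z' -> z = z'.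
Proof.
  intros (o & Ho & s & Hs & Hz) (o' & Ho' & s' & Hs' & Hz').
  rewrite <- (sing_unique _ _ _ Hs Hs') in Hz'.
  apply is_empty_iff in Ho, Ho'.
  rewrite <- (collects_unique _ _ _ _ Ho Ho') in Hz' by tauto.
  apply is_upair_iff in Hz, Hz'. now apply (collects_unique _ _ _ _ Hz Hz').
Qed.

Lemma sing_not_empty a z : is_sing a z -> ~ is_empty z.
Proof. rewrite is_sing_iff, is_empty_iff. intros H H'. apply (proj1 (H' a)), (proj1 (H a)). reflexivity. Qed.

Lemma tag_inj y y' z : is_tag y z -> is_tag y' z -> y = y'.
Proof.
  intros (o & Ho & s & Hs & Hz) (o' & Ho' & s' & Hs' & Hz').
  apply is_upair_iff in Hz, Hz'.
  assert (Hin : s = o' \/ s = s') by (apply (proj1 (Hz' s)), (proj1 (Hz s)); now right).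
  destruct Hin as [->| ->].
  - now apply sing_not_empty in Hs.
  - now apply (sing_inj _ _ s').
Qed.

(** The codes for the two coordinates never collide, because {∅,{y}} has the two distinct members ∅
    and {y}. *)
Lemma sing_not_tag a y z : is_sing a z -> ~ is_tag y z.
Proof.
  intros H (o & Ho & s & Hs & Hz). apply is_sing_iff in H. apply is_upair_iff in Hz.
  assert (o = a) by (apply (proj1 (H o)), (proj1 (Hz o)); now left).
  assert (s = a) by (apply (proj1 (H s)), (proj1 (Hz s)); now right).
  subst. now apply sing_not_empty in Hs.
Qed.

Lemma definable_is_sing (s t : (nat -> M) -> M) :
  def_term s -> def_term t -> definable (fun e => is_sing (s e) (t e)).
Proof. intros. unfold is_sing, is_upair, is_set_of. dfn. Qed.

Lemma definable_is_tag (s t : (nat -> M) -> M) :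
  def_term s -> def_term t -> definable (fun e => is_tag (s e) (t e)).
Proof. intros. unfold is_tag, is_sing, is_upair, is_empty, is_set_of. dfn. Qed.

Lemma definable_is_opair (s t u : (nat -> M) -> M) :
  def_term s -> def_term t -> def_term u ->
  definable (fun e => is_opair (s e) (t e) (u e)).
Proof.
  intros. unfold is_opair, is_tag, is_sing, is_upair, is_empty, is_set_of. dfn.
Qed.

Lemma definable_pair_mem (s t u : (nat -> M) -> M) :
  def_term s -> def_term t -> def_term u ->
  definable (fun e => pair_mem (s e) (t e) (u e)).
Proof.
  intros. unfold pair_mem, is_opair, is_tag, is_sing, is_upair, is_empty, is_set_of. dfn.
Qed.

Lemma pair_code_bounded (T S : M -> Prop) : bounded T -> bounded S ->
  bounded (fun z => (exists x, is_sing x z /\ T x) \/ (exists y, is_tag y z /\ S y)).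
Proof.
  intros [A HA] [B HB]. apply bounded_or.
  - destruct (replacement is_sing A) as [C HC].
    + intros s t Hs Ht. now apply definable_is_sing.
    + intros x y z _. apply sing_unique.
    + exists C. intros z (x & Hz & Hx). apply (HC z). eauto.
  - destruct (replacement is_tag B) as [C HC].
    + intros s t Hs Ht. now apply definable_is_tag.
    + intros x y z _. apply tag_unique.
    + exists C. intros z (x & Hz & Hx). apply (HC z). eauto.
Qed.

Lemma opair_ex a b : exists p, is_opair a b p.
Proof.
  destruct (angle_ex
    (fun z => (exists x, is_sing x z /\ x ∈+ a) \/ (exists y, is_tag y z /\ y ∈+ b))
    (fun z => (exists x, is_sing x z /\ ~ x ∈- a) \/ (exists y, is_tag y z /\ ~ y ∈- b)))
    as [p Hp].
  1,2: unfold is_tag, is_sing, is_upair, is_empty, is_set_of; red; dfn.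
  - apply pair_code_bounded; apply bounded_in.
  - apply pair_code_bounded; apply bounded_pot.
  - exists p. intros z. destruct (Hp z) as [-> ->]. split; [tauto|]. split.
    + intros H. split; intros x Hx; apply NNPP; intros N; apply H; eauto.
    + intros [H H'] [(x & Hx & N)|(y & Hy & N)]; auto.
Qed.

Lemma opair_unique a b p p' : is_opair a b p -> is_opair a b p' -> p = p'.
Proof.
  intros H H'. apply set_eq. intros z. destruct (H z) as [-> ->]. destruct (H' z) as [-> ->]. tauto.
Qed.

Lemma opair_sing a b p x z : is_opair a b p -> is_sing x z ->
  (z ∈+ p <-> x ∈+ a) /\ (z ∈- p <-> x ∈- a).
Proof.
  intros H Hz. destruct (H z) as [-> ->]. split; split.
  - intros [(x' & Hx & K)|(y & Hy & K)].
    + now rewrite (sing_inj _ _ _ Hz Hx).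
    + now apply (sing_not_tag _ _ _ Hz) in Hy.
  - eauto.
  - intros [K _]. auto.
  - intros K. split.
    + intros x' Hx. now rewrite (sing_inj _ _ _ Hx Hz).
    + intros y Hy. now apply (sing_not_tag _ _ _ Hz) in Hy.
Qed.

Lemma opair_tag a b p y z : is_opair a b p -> is_tag y z ->
  (z ∈+ p <-> y ∈+ b) /\ (z ∈- p <-> y ∈- b).
Proof.
  intros H Hz. destruct (H z) as [-> ->]. split; split.
  - intros [(x & Hx & K)|(y' & Hy & K)].
    + now apply (sing_not_tag _ _ _ Hx) in Hz.
    + now rewrite (tag_inj _ _ _ Hz Hy).
  - eauto.
  - intros [_ K]. auto.
  - intros K. split.
    + intros x Hx. now apply (sing_not_tag _ _ _ Hx) in Hz.
    + intros y' Hy. now rewrite (tag_inj _ _ _ Hy Hz).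
Qed.

Lemma opair_inj a b c d p : is_opair a b p -> is_opair c d p -> a = c /\ b = d.
Proof.
  intros H H'. split; apply set_eq; intros x.
  - destruct (upair_ex x x) as [z Hz].
    destruct (opair_sing _ _ _ _ _ H Hz), (opair_sing _ _ _ _ _ H' Hz). tauto.
  - destruct (tag_ex x) as [z Hz].
    destruct (opair_tag _ _ _ _ _ H Hz), (opair_tag _ _ _ _ _ H' Hz). tauto.
Qed.

Lemma opair_eq_neg a b c d p q : is_opair a b p -> is_opair c d q ->
  (eq_neg M p q <-> eq_neg M a c \/ eq_neg M b d).
Proof.
  intros H H'. rewrite !eq_neg_iff. split.
  - intros (z & Hz).
    (* A witness of the disequality is true in one of the two pairs, hence is a code of one of the
       two kinds. *)
    assert (K : (exists x, is_sing x z) \/ (exists y, is_tag y z)).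
    { destruct (H z) as [E _], (H' z) as [E' _].
      destruct Hz as [[Hz _]|[_ Hz]]; [apply E in Hz|apply E' in Hz];
        destruct Hz as [(x & K & _)|(x & K & _)]; eauto. }
    destruct K as [[x Hx]|[y Hy]].
    + left. exists x. destruct (opair_sing _ _ _ _ _ H Hx), (opair_sing _ _ _ _ _ H' Hx). tauto.
    + right. exists y. destruct (opair_tag _ _ _ _ _ H Hy), (opair_tag _ _ _ _ _ H' Hy). tauto.
  - intros [(x & Hx)|(y & Hy)].
    + destruct (upair_ex x x) as [z Hz]. exists z.
      destruct (opair_sing _ _ _ _ _ H Hz), (opair_sing _ _ _ _ _ H' Hz). tauto.
    + destruct (tag_ex y) as [z Hz]. exists z.
      destruct (opair_tag _ _ _ _ _ H Hz), (opair_tag _ _ _ _ _ H' Hz). tauto.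
Qed.

End Pairs.

Ltac def_notion ::= first [apply definable_pair_mem | apply definable_is_opair].

(** * Injections *)

Section Functions.
Context {M : model} {HM : bzfc_model M}.
Implicit Types (A B P Q X Y a b c d x y z p q f g h u v : carrier M).

Lemma relation_set (R : M -> M -> Prop) X : definable2 R ->
  (forall x y z, x ∈+ X -> R x y -> R x z -> y = z) ->
  exists f, cls f /\ (forall p, p ∈+ f -> exists a b, is_opair a b p) /\
    forall x y, pair_mem x y f <-> x ∈+ X /\ R x y.
Proof.
  intros D HR.
  destruct (replacement (fun x p => exists y, R x y /\ is_opair x y p) X) as [f Hf].
  - red. dfn.
  - intros x p q Hx (y & Hy & Hp) (z & Hz & Hq).
    rewrite (HR x y z Hx Hy Hz) in Hp. now apply (opair_unique _ _ _ _ Hp).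
  - exists f. split; [now apply (collects_cls _ _ Hf)|]. split.
    + intros p Hp. apply (Hf p) in Hp. destruct Hp as (x & _ & y & _ & Hp). eauto.
    + intros x y. split.
      * intros (p & Hp & K). apply (Hf p) in K. destruct K as (x' & Hx & y' & Hy & Hp').
        destruct (opair_inj _ _ _ _ _ Hp Hp') as [-> ->]. auto.
      * intros [Hx Hy]. destruct (opair_ex x y) as [p Hp]. exists p.
        split; [exact Hp|]. apply (Hf p). eauto.
Qed.

(** Every clause looks only at arguments in [X], so [f] may contain further pairs and need not be
    cut down before it is reused on a smaller set. *)
Record embeds f X Y : Prop := {
  emb_total : forall x, x ∈+ X -> exists y, pair_mem x y f;
  emb_range : forall x y, x ∈+ X -> pair_mem x y f -> y ∈+ Y;
  emb_fun : forall x y z, x ∈+ X -> pair_mem x y f -> pair_mem x z f -> y = z;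
  emb_inj : forall x x' y, x ∈+ X -> x' ∈+ X -> pair_mem x y f -> pair_mem x' y f -> x = x' }.

Definition bijects f X Y : Prop :=
  embeds f X Y /\ forall y, y ∈+ Y -> exists x, x ∈+ X /\ pair_mem x y f.

Definition equipotent X Y : Prop := exists f, bijects f X Y.

Lemma embedding_set (R : M -> M -> Prop) X Y : definable2 R ->
  (forall x, x ∈+ X -> exists y, R x y) ->
  (forall x y, x ∈+ X -> R x y -> y ∈+ Y) ->
  (forall x y z, x ∈+ X -> R x y -> R x z -> y = z) ->
  (forall x x' y, x ∈+ X -> x' ∈+ X -> R x y -> R x' y -> x = x') ->
  exists f, embeds f X Y /\ forall x y, pair_mem x y f <-> x ∈+ X /\ R x y.
Proof.
  intros D HT HY HF HI. destruct (relation_set R X D HF) as (f & _ & _ & Hf).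
  exists f. split; [|exact Hf]. split.
  - intros x Hx. destruct (HT x Hx) as [y Hy]. exists y. now apply Hf.
  - intros x y Hx Hxy. apply Hf in Hxy as [_ Hxy]. eauto.
  - intros x y z Hx Hy Hz. apply Hf in Hy as [_ Hy], Hz as [_ Hz]. eauto.
  - intros x x' y Hx Hx' Hy Hz. apply Hf in Hy as [_ Hy], Hz as [_ Hz]. eauto.
Qed.

Lemma embeds_sub X Y : (forall x, x ∈+ X -> x ∈+ Y) -> exists f, embeds f X Y.
Proof.
  intros H. destruct (embedding_set (fun x y => x = y) X Y) as (f & Hf & _).
  - red. dfn.
  - eauto.
  - intros; subst; auto.
  - congruence.
  - congruence.
  - eauto.
Qed.

Lemma embeds_trans f g X Y Z : embeds f X Y -> embeds g Y Z -> exists h, embeds h X Z.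
Proof.
  intros [TF RF FF IF] [TG RG FG IG].
  destruct (embedding_set (fun x z => exists y, pair_mem x y f /\ pair_mem y z g) X Z)
    as (h & Hh & _).
  - red. dfn.
  - intros x Hx. destruct (TF x Hx) as [y Hy]. destruct (TG y) as [z Hz]; eauto.
  - intros x z Hx (y & H1 & H2). eauto.
  - intros x z z' Hx (y & H1 & H2) (y' & H1' & H2').
    rewrite (FF x y' y) in H2' by auto. apply (FG y); eauto.
  - intros x x' z Hx Hx' (y & H1 & H2) (y' & H1' & H2').
    rewrite (IG y' y z) in H1' by eauto. eauto.
  - eauto.
Qed.

Lemma equipotent_sym X Y : equipotent X Y -> equipotent Y X.
Proof.
  intros (f & [TF RF FF IF] & S).
  destruct (embedding_set (fun y x => x ∈+ X /\ pair_mem x y f) Y X) as (g & Hg & K).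
  - red. dfn.
  - exact S.
  - tauto.
  - intros y x x' _ [? ?] [? ?]. eauto.
  - intros y y' x _ _ [? ?] [? ?]. eauto.
  - exists g. split; [exact Hg|]. intros x Hx. destruct (TF x Hx) as [y Hy].
    exists y. split; [eauto|]. apply K. eauto.
Qed.

Lemma equipotent_embeds X Y : equipotent X Y -> exists f, embeds f X Y.
Proof. intros (f & H & _). eauto. Qed.

Lemma is_classical_iff A : is_classical A <-> cls A.
Proof. split; intros H x; specialize (H x); tauto. Qed.

Lemma pair_nonmem_iff f x y : cls f -> (pair_nonmem x y f <-> ~ pair_mem x y f).
Proof.
  intros Hf. split.
  - intros H (p & Hp & K). apply (Hf p) in K. apply K, H, Hp.
  - intros H p Hp. apply NNPP. intros N. apply H. exists p. split; [exact Hp|]. now apply Hf.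
Qed.

Lemma is_dom_iff f X : cls f -> (is_dom f X <-> collects X (fun x => exists y, pair_mem x y f)).
Proof.
  intros Hf. apply is_set_of_iff; [tauto|]. intros x. split.
  - intros H [y Hy]. now apply (pair_nonmem_iff f x y Hf) in H.
  - intros H y. apply pair_nonmem_iff; eauto.
Qed.

Lemma is_ran_iff f Y : cls f -> (is_ran f Y <-> collects Y (fun y => exists x, pair_mem x y f)).
Proof.
  intros Hf. apply is_set_of_iff; [tauto|]. intros y. split.
  - intros H [x Hx]. now apply (pair_nonmem_iff f x y Hf) in H.
  - intros H x. apply pair_nonmem_iff; eauto.
Qed.

Lemma injection_embeds f X Y :
  is_injection f -> is_dom f X -> (forall x y, pair_mem x y f -> y ∈+ Y) -> embeds f X Y.
Proof.
  intros ((Hc & _ & HF) & HI) HX HY. apply is_classical_iff in Hc.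
  apply is_dom_iff in HX; [|exact Hc]. split.
  - intros x Hx. now apply (HX x) in Hx.
  - eauto.
  - intros x y z _ Hy Hz. now apply (HF x y z).
  - intros x x' y _ _ Hy Hz. now apply (HI x x' y).
Qed.

Lemma embedding_injection (R : M -> M -> Prop) X : cls X -> definable2 R ->
  (forall x, x ∈+ X -> exists y, R x y) ->
  (forall x y z, x ∈+ X -> R x y -> R x z -> y = z) ->
  (forall x x' y, x ∈+ X -> x' ∈+ X -> R x y -> R x' y -> x = x') ->
  exists f, is_injection f /\ is_dom f X /\
    forall x y, pair_mem x y f <-> x ∈+ X /\ R x y.
Proof.
  intros HX D HT HF HI. destruct (relation_set R X D HF) as (f & Hc & Hp & Hf).
  exists f. split; [|split; [|exact Hf]].
  - split; [split; [now apply is_classical_iff|split; [exact Hp|]]|].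
    + intros a b c [H1 H2]. apply Hf in H1 as [Ha H1], H2 as [_ H2]. split; eauto.
    + intros a b c [H1 H2]. apply Hf in H1 as [Ha H1], H2 as [Hb H2]. split; eauto.
  - apply is_dom_iff; [exact Hc|]. apply cls_collects; [exact HX|]. intros x. split.
    + intros Hx. destruct (HT x Hx) as [y Hy]. exists y. now apply Hf.
    + intros [y Hy]. now apply Hf in Hy.
Qed.

Lemma is_bijective_iff X Y : cls X -> cls Y -> (is_bijective X Y <-> equipotent X Y).
Proof.
  intros HX HY. split.
  - intros (f & Hi & Hd & Hr). pose proof Hi as [[Hc _] _]. apply is_classical_iff in Hc.
    apply is_ran_iff in Hr; [|exact Hc]. exists f. split.
    + apply injection_embeds; auto. intros x y H. apply (Hr y). eauto.
    + intros y Hy. apply (Hr y) in Hy. destruct Hy as [x Hx]. exists x. split; [|exact Hx].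
      apply is_dom_iff in Hd; [|exact Hc]. apply (Hd x). eauto.
  - intros (f & [TF RF FF IF] & S).
    destruct (embedding_injection (fun x y => pair_mem x y f) X) as (g & Hi & Hd & Hg); auto.
    + red. dfn.
    + exists g. split; [exact Hi|split; [exact Hd|]].
      pose proof Hi as [[Hc _] _]. apply is_classical_iff in Hc. apply is_ran_iff; [exact Hc|].
      apply cls_collects; [exact HY|]. intros y. split.
      * intros Hy. destruct (S y Hy) as (x & Hx & Hxy). exists x. now apply Hg.
      * intros [x Hx]. apply Hg in Hx as [Hx Hxy]. eauto.
Qed.

(** The injections [h] on [P] and [h'] on [Q] are combined as in the
    Cantor-Bernstein theorem: [h] is used on the orbits that start outside the
    range of [h']. *)
Lemma common_matching h h' P Q P' Q' : embeds h P Q' -> embeds h' Q P' ->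
  exists m,
    (forall a b, pair_mem a b m -> (a ∈+ P /\ pair_mem a b h) \/ (b ∈+ Q /\ pair_mem b a h')) /\
    (forall a b c, pair_mem a b m -> pair_mem a c m -> b = c) /\
    (forall a b c, pair_mem a c m -> pair_mem b c m -> a = b) /\
    (forall a, a ∈+ P -> exists b, pair_mem a b m) /\
    (forall b, b ∈+ Q -> exists a, pair_mem a b m).
Proof.
  intros [T R F I] [T' R' F' I'].
  set (base := fun a => ~ exists b, b ∈+ Q /\ pair_mem b a h').
  set (step := fun a c => exists b, pair_mem a b h /\ b ∈+ Q /\ pair_mem b c h').
  (* [S] is the least part of [P] that contains [base] and is closed under [step] within [P],
     obtained as an intersection instead of a union over natural numbers. *)
  destruct (collect (fun a => a ∈+ P /\ forall W : M,
    (forall x, x ∈+ P -> base x -> x ∈+ W) ->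
    (forall x y, x ∈+ W -> y ∈+ P -> step x y -> y ∈+ W) -> a ∈+ W)) as [S HS].
  { subst base step. red. dfn. }
  { apply (bounded_sub _ (fun a => a ∈+ P)); [tauto|apply bounded_in]. }
  assert (SP : forall a, a ∈+ S -> a ∈+ P) by (intros a Ha; now apply (HS a) in Ha).
  assert (Sbase : forall a, a ∈+ P -> base a -> a ∈+ S) by (intros a Ha Hb; apply (HS a); auto).
  assert (Sstep : forall a c, a ∈+ S -> c ∈+ P -> step a c -> c ∈+ S).
  { intros a c Ha Hc H. apply (HS c). split; [exact Hc|]. intros W H1 H2.
    apply (H2 a); auto. apply (HS a) in Ha. apply Ha; auto. }
  (* By minimality of [S]: the members of [S] with the stated property again contain [base] and are
     closed under [step]. *)
  assert (Sinv : forall a, a ∈+ S -> base a \/ exists s, s ∈+ S /\ step s a).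
  { destruct (collect (fun a => a ∈+ S /\ (base a \/ exists s, s ∈+ S /\ step s a))) as [W HW].
    - subst base step. red. dfn.
    - apply (bounded_sub _ (fun a => a ∈+ S)); [tauto|apply bounded_in].
    - intros a Ha. apply (HW a). apply (HS a) in Ha. apply Ha.
      + intros x Hx Hb. apply (HW x). auto.
      + intros x y Hx Hy H. apply (HW x) in Hx. apply (HW y). destruct Hx. eauto 6. }
  (* The domain of [m] may leave [P], since [h'] takes its values in [P']. *)
  destruct (collect (fun a => a ∈+ P \/ a ∈+ P')) as [U HU].
  { red. dfn. } { apply bounded_or; apply bounded_in. }
  set (free := fun b => ~ exists s, s ∈+ S /\ pair_mem s b h).
  set (G := fun a b => (a ∈+ S /\ pair_mem a b h) \/ (b ∈+ Q /\ pair_mem b a h' /\ free b)).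
  (* A member of [S] that is a value [h'](c) is not in [base], so it was reached by a step through
     c; then c is a value of [h] on [S] and is not free. *)
  assert (mixed : forall a b c, a ∈+ S -> pair_mem a b h ->
    c ∈+ Q -> pair_mem c a h' -> free c -> False).
  { intros a b c Ha _ Hc Hca Hf. destruct (Sinv a Ha) as [Hb|(s & Hs & d & H1 & H2 & H3)].
    - apply Hb. eauto.
    - apply Hf. exists s. split; [exact Hs|]. now rewrite <- (I' d c a). }
  destruct (relation_set G U) as (m & _ & _ & Hm).
  { subst G free. red. dfn. }
  { intros a b c _ [[H1 H2]|(H1 & H2 & H3)] [[K1 K2]|(K1 & K2 & K3)].
    - eauto.
    - exfalso. eauto.
    - exfalso. eauto.
    - eauto. }
  assert (Hm' : forall a b, pair_mem a b m <-> G a b).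
  { intros a b. rewrite Hm. split; [tauto|]. intros H. split; [|exact H].
    apply (HU a). destruct H as [[H _]|(H1 & H2 & _)]; eauto. }
  exists m. split; [|split; [|split; [|split]]].
  - intros a b H. apply Hm' in H as [[H1 H2]|(H1 & H2 & _)]; auto.
  - intros a b c H K. apply Hm' in H. apply Hm' in K.
    destruct H as [[H1 H2]|(H1 & H2 & H3)], K as [[K1 K2]|(K1 & K2 & K3)].
    + eauto.
    + exfalso. eauto.
    + exfalso. eauto.
    + eauto.
  - intros a b c H K. apply Hm' in H. apply Hm' in K.
    destruct H as [[H1 H2]|(H1 & H2 & H3)], K as [[K1 K2]|(K1 & K2 & K3)].
    + eauto.
    + exfalso. apply K3. eauto.
    + exfalso. apply H3. eauto.
    + eauto.
  - intros a Ha. destruct (classic (a ∈+ S)) as [Hs|Hs].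
    + destruct (T a Ha) as [b Hb]. exists b. apply Hm'. left. auto.
    + assert (Hb : ~ base a) by auto. apply NNPP in Hb. destruct Hb as (b & Hb & Hba).
      exists b. apply Hm'. right. split; [exact Hb|split; [exact Hba|]].
      intros (s & H1 & H2). apply Hs. apply (Sstep s a H1 Ha). exists b. auto.
  - intros b Hb. destruct (classic (free b)) as [Hf|Hf].
    + destruct (T' b Hb) as [a Ha]. exists a. apply Hm'. right. auto.
    + apply NNPP in Hf. destruct Hf as (s & H1 & H2). exists s. apply Hm'. left. auto.
Qed.

(** The case [P] = [P'] and [Q] = [Q'] of [common_matching], where covering both sides makes the
    matching a bijection. *)
Lemma cantor_bernstein f g X Y : embeds f X Y -> embeds g Y X -> equipotent X Y.
Proof.
  intros Hf Hg. destruct (common_matching f g X Y X Y Hf Hg) as (m & H0 & H1 & H2 & H3 & H4).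
  destruct Hf, Hg.
  exists m. split; [split|]; eauto.
  - intros x y Hx H. destruct (H0 x y H) as [[_ K]|[K _]]; eauto.
  - intros y Hy. destruct (H4 y Hy) as [x Hx]. exists x. split; [|exact Hx].
    destruct (H0 x y Hx) as [[K _]|[K1 K2]]; eauto.
Qed.

Lemma equipotent_refl X : equipotent X X.
Proof.
  destruct (embeds_sub X X) as [f Hf]; [auto|]. exact (cantor_bernstein _ _ _ _ Hf Hf).
Qed.

Lemma equipotent_trans X Y Z : equipotent X Y -> equipotent Y Z -> equipotent X Z.
Proof.
  intros HXY HYZ.
  destruct (equipotent_embeds _ _ HXY) as [f Hf], (equipotent_embeds _ _ HYZ) as [g Hg].
  destruct (equipotent_embeds _ _ (equipotent_sym _ _ HXY)) as [f' Hf'].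
  destruct (equipotent_embeds _ _ (equipotent_sym _ _ HYZ)) as [g' Hg'].
  destruct (embeds_trans _ _ _ _ _ Hf Hg) as [h Hh].
  destruct (embeds_trans _ _ _ _ _ Hg' Hf') as [h' Hh'].
  exact (cantor_bernstein _ _ _ _ Hh Hh').
Qed.

(** Follow [x], [x'], [x''], ... where [i x = j x'] with [x'] in [X1].  The
    map [i] serves along the chains that never end; on a chain that ends in
    [t], [j] serves at the members of [X1] and a starting point outside [X1] is
    sent to [i t]. *)
Lemma refine_embedding i j X Y X1 Y1 : embeds i X Y -> embeds j X1 Y1 ->
  (forall x, x ∈+ X1 -> x ∈+ X) -> (forall y, y ∈+ Y1 -> y ∈+ Y) ->
  exists h, embeds h X Y /\ forall x y, x ∈+ X1 -> pair_mem x y h -> y ∈+ Y1.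
Proof.
  intros [T R F I] [T' R' F' I'] SX SY.
  set (step := fun u v => u ∈+ X /\ v ∈+ X1 /\ exists y, pair_mem u y i /\ pair_mem v y j).
  set (reach := fun a b => forall W : M, a ∈+ W ->
    (forall u v, u ∈+ W -> step u v -> v ∈+ W) -> b ∈+ W).
  set (ends := fun t => t ∈+ X /\ ~ exists v, step t v).
  set (exits := fun a => exists t, reach a t /\ ends t).
  assert (step_fun : forall u v w, step u v -> step u w -> v = w).
  { intros u v w (H1 & H2 & y & H3 & H4) (K1 & K2 & z & K3 & K4).
    rewrite (F u z y) in K4 by auto. eauto. }
  assert (step_inj : forall u v w, step u w -> step v w -> u = v).
  { intros u v w (H1 & H2 & y & H3 & H4) (K1 & K2 & z & K3 & K4).
    rewrite (F' w z y) in K3 by auto. eauto. }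
  assert (reach_refl : forall a, reach a a) by (intros a W Ha _; exact Ha).
  assert (reach_trans : forall a b c, reach a b -> reach b c -> reach a c).
  { intros a b c Hab Hbc W Ha HW. apply Hbc; auto. }
  assert (reach_step : forall a b, step a b -> reach a b) by (intros a b H W Ha HW; eauto).
  (* Induction along a chain. It is confined to definable [K] because the instance of [W] has to be
     a set; Comprehension forms it inside [X], which a chain never leaves. *)
  assert (reach_ind : forall (K : M -> Prop) a b, definable1 K -> a ∈+ X -> reach a b ->
    K a -> (forall u v, reach a u -> K u -> step u v -> K v) -> K b).
  { intros K a b D Ha Hab Ka HK.
    destruct (collect (fun u => u ∈+ X /\ reach a u /\ K u)) as [W HW].
    - subst reach step. red. dfn.
    - apply (bounded_sub _ (fun u => u ∈+ X)); [tauto|apply bounded_in].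
    - apply (HW b). apply Hab; [apply (HW a); auto|].
      intros u v Hu Huv. apply (HW u) in Hu. destruct Hu as (H1 & H2 & H3). apply (HW v).
      split; [|split; eauto]. apply SX, Huv. }
  assert (reach_X : forall a b, a ∈+ X -> reach a b -> b ∈+ X).
  { intros a b Ha Hab. apply Hab; [exact Ha|]. intros u v _ H. apply SX, H. }
  assert (reach_first : forall a b, a ∈+ X -> reach a b ->
    b = a \/ exists c, step a c /\ reach c b).
  { intros a b Ha Hab. apply (reach_ind (fun b => b = a \/ exists c, step a c /\ reach c b) a b); auto.
    - subst reach step. red. dfn.
    - intros u v _ [->|(c & H1 & H2)] Huv; right; eauto. }
  assert (reach_last : forall a b, a ∈+ X -> reach a b ->
    b = a \/ exists c, reach a c /\ step c b).
  { intros a b Ha Hab. apply (reach_ind (fun b => b = a \/ exists c, reach a c /\ step c b) a b); auto.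
    - subst reach step. red. dfn.
    - intros u v Hu _ Huv. right. eauto. }
  assert (end_unique : forall a t t', a ∈+ X -> reach a t -> ends t -> reach a t' -> ends t' -> t = t').
  { intros a t t' Ha Ht [Xt Et] Ht' [Xt' Et'].
    assert (K : reach t' t).
    { apply (reach_ind (fun b => reach b t) a t'); auto.
      - subst reach step. red. dfn.
      - intros u v Hu Hut Huv. destruct (reach_first u t) as [<-|(c & H1 & H2)].
        + apply Huv.
        + exact Hut.
        + exfalso. eauto.
        + now rewrite (step_fun u v c). }
    destruct (reach_first t' t Xt' K) as [E|(c & H1 & _)]; [exact E|exfalso; eauto]. }
  (* Steps are injective, so two chains that meet can be followed back until one start lies on the
     chain of the other. A point outside [X1] has no predecessor, so the starts coincide. *)
  assert (start_unique : forall a b t, a ∈+ X -> b ∈+ X -> ~ a ∈+ X1 -> ~ b ∈+ X1 ->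
    reach a t -> reach b t -> a = b).
  { intros a b t Ha Hb Na Nb Hat Hbt.
    assert (K : reach b a \/ reach a b).
    { revert Hbt. apply (reach_ind (fun t => reach b t -> reach b a \/ reach a b) a t); auto.
      - subst reach step. red. dfn.
      - intros u v Hau IH Huv Hbv. destruct (reach_last b v Hb Hbv) as [<-|(c & H1 & H2)]; eauto.
        rewrite (step_inj _ _ _ H2 Huv) in H1. auto. }
    destruct K as [K|K]; apply reach_last in K; auto;
      destruct K as [K|(c & _ & _ & K & _)]; auto; tauto. }
  assert (exits_step : forall u v, step u v -> exits v -> exits u).
  { intros u v H (t & H1 & H2). exists t. eauto. }
  assert (end_exits : forall u, ends u -> exits u) by (intros u Hu; exists u; auto).
  (* The value i(t) is available to the starting point: it is no value of [j] on [X1], as [t] has no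
     successor, and [t] does not claim it, being either in [X1] and served by [j] or the starting
     point itself. *)
  set (G := fun x y => (~ exits x /\ pair_mem x y i) \/
    (exits x /\ x ∈+ X1 /\ pair_mem x y j) \/
    (~ x ∈+ X1 /\ exists t, reach x t /\ ends t /\ pair_mem t y i)).
  (* The three clauses of [G] have disjoint ranges: i(x) = j(x') would be a step from [x] to [x'],
     letting [x] exit if [x'] does and giving an end a successor. *)
  assert (G12 : forall x x' y, x ∈+ X -> ~ exits x -> pair_mem x y i ->
    exits x' -> x' ∈+ X1 -> pair_mem x' y j -> False).
  { intros x x' y Hx Nx H Hx' X1x' H'. apply Nx, (exits_step x x'); [|exact Hx'].
    split; [exact Hx|split; [exact X1x'|eauto]]. }
  assert (G13 : forall x t y, x ∈+ X -> ~ exits x -> pair_mem x y i ->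
    ends t -> pair_mem t y i -> False).
  { intros x t y Hx Nx H Ht H'. apply Nx. rewrite (I x t y); auto. apply Ht. }
  assert (G23 : forall x t y, x ∈+ X1 -> pair_mem x y j -> ends t -> pair_mem t y i -> False).
  { intros x t y Hx H [Xt Ht] H'. apply Ht. exists x. split; [exact Xt|split; [exact Hx|eauto]]. }
  destruct (embedding_set G X Y) as (h & Hh & K).
  - subst G exits ends reach step. red. dfn.
  - intros x Hx. destruct (classic (exits x)) as [He|He].
    + destruct (classic (x ∈+ X1)) as [H1|H1].
      * destruct (T' x H1) as [y Hy]. exists y. right. left. auto.
      * destruct He as (t & Ht & Et). destruct (T t) as [y Hy]; [apply Et|].
        exists y. right. right. eauto.
    + destruct (T x Hx) as [y Hy]. exists y. left. auto.
  - intros x y Hx [[_ H]|[(_ & H1 & H)|(_ & t & _ & [Ht _] & H)]]; eauto.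
  - intros x y z Hx [[N1 H]|[(E1 & H1 & H)|(N1 & t & Rt & Et & H)]]
      [[N2 K]|[(E2 & K1 & K)|(N2 & t' & Rt' & Et' & K)]]; try tauto.
    + eauto.
    + exfalso. apply N1. exists t'. auto.
    + eauto.
    + exfalso. apply N2. exists t. auto.
    + rewrite (end_unique x t t') in H by auto. apply (F t'); auto. apply Et'.
  - intros x x' y Hx Hx' [[N1 H]|[(E1 & H1 & H)|(N1 & t & Rt & Et & H)]]
      [[N2 K]|[(E2 & K1 & K)|(N2 & t' & Rt' & Et' & K)]]; try (exfalso; eauto; fail).
    + eauto.
    + eauto.
    + apply (start_unique x x' t); auto. rewrite (I t t' y); auto; [apply Et|apply Et'].
  - exists h. split; [exact Hh|]. intros x y Hx Hxy. apply K in Hxy as [_ Hxy].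
    destruct Hxy as [[N H]|[(_ & _ & H)|(N & _)]].
    + assert (Hs : exists v, step x v).
      { apply NNPP. intros N'. apply N, end_exits. split; auto. }
      destruct Hs as (v & Xv & V1 & z & H1 & H2). rewrite (F x y z); eauto.
    + eauto.
    + tauto.
Qed.

End Functions.

(** * Ordinals *)

Section Ordinals.
Context {M : model} {HM : bzfc_model M}.
Implicit Types (A B S X Y a b c d k m o x y z p q f g h u v : carrier M).

Record ord a : Prop := {
  ord_cls : cls a;
  ord_mem_cls : forall x, x ∈+ a -> cls x;
  ord_down : forall x y, x ∈+ a -> y ∈+ x -> y ∈+ a;
  ord_mem_irrefl : forall x, x ∈+ a -> ~ x ∈+ x;
  ord_mem_trans : forall x y z, x ∈+ a -> y ∈+ a -> z ∈+ a -> x ∈+ y -> y ∈+ z -> x ∈+ z;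
  ord_mem_total : forall x y, x ∈+ a -> y ∈+ a -> x ∈+ y \/ x = y \/ y ∈+ x;
  ord_min : forall S, cls S -> (forall x, x ∈+ S -> x ∈+ a) -> (exists x, x ∈+ S) ->
    exists m, m ∈+ S /\ forall x, x ∈+ S -> m ∈+ x \/ m = x }.

Lemma is_ordinal_iff a : is_ordinal a <-> ord a.
Proof.
  split.
  - intros (H1 & H2 & H3 & H4 & H5 & H6 & H7). apply is_classical_iff in H1. split; auto.
    + intros x Hx. apply is_classical_iff; auto.
    + intros x y Hx. exact (H3 x Hx y).
    + intros x y z Hx Hy Hz Hxy Hyz. apply (H5 x Hx y Hy z Hz). auto.
    + intros S HS HSa HSn. apply H7. split; [now apply is_classical_iff|]. split; [|exact HSn].
      intros x. split; [apply HSa|]. intros Hx. apply NNPP. intros N. apply HS, HSa in N.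
      now apply (H1 x) in N.
  - intros [H1 H2 H3 H4 H5 H6 H7]. pose proof H1 as H0. apply is_classical_iff in H1.
    split; [exact H1|]. split; [|split; [|split; [|split; [|split]]]].
    + intros x Hx. apply is_classical_iff; auto.
    + intros x Hx y Hy. now apply (H3 x).
    + exact H4.
    + intros x Hx y Hy z Hz [? ?]. eauto.
    + auto.
    + intros S (HS & HSa & HSn). apply H7; [now apply is_classical_iff| |exact HSn].
      intros x. apply HSa.
Qed.

Lemma ord_mem a x : ord a -> x ∈+ a -> ord x.
Proof.
  intros Ha Hx. assert (K : forall y, y ∈+ x -> y ∈+ a) by (intros y; now apply ord_down).
  split.
  - now apply (ord_mem_cls a).
  - intros y Hy. apply (ord_mem_cls a); auto.
  - intros y z Hy Hz. apply (ord_mem_trans a Ha z y x); auto. now apply (ord_down a Ha y); auto.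
  - intros y Hy. apply (ord_mem_irrefl a); auto.
  - intros y z w Hy Hz Hw. apply (ord_mem_trans a); auto.
  - intros y z Hy Hz. apply (ord_mem_total a); auto.
  - intros S HS HSx. apply (ord_min a); auto.
Qed.

Lemma ord_irrefl a : ord a -> ~ a ∈+ a.
Proof. intros Ha H. exact (ord_mem_irrefl a Ha a H H). Qed.

Lemma ord_asym a b : ord a -> a ∈+ b -> b ∈+ a -> False.
Proof. intros Ha H K. apply (ord_irrefl a Ha). now apply (ord_down a Ha b). Qed.

(** If [c] is not all of [a], it equals the least member of [a] outside [c]. *)
Lemma ord_segment a c : ord a -> cls c -> (forall x, x ∈+ c -> x ∈+ a) ->
  (forall x y, x ∈+ c -> y ∈+ x -> y ∈+ c) -> c = a \/ c ∈+ a.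
Proof.
  intros Ha Hc Hca Ht. destruct (collect (fun x => x ∈+ a /\ ~ x ∈+ c)) as [D HD].
  { red. dfn. } { exists a. tauto. }
  destruct (classic (exists x, x ∈+ D)) as [HN|HN].
  - right. destruct (ord_min a Ha D) as (m & Hm & Hmin); auto.
    { now apply (collects_cls _ _ HD). } { intros x Hx. now apply (HD x) in Hx. }
    apply (HD m) in Hm as [Hma Hmc]. replace c with m; [exact Hma|].
    apply cls_eq; [now apply (ord_mem_cls a)|exact Hc|]. intros x. split.
    + intros Hx. apply NNPP. intros N. assert (Hxa : x ∈+ a) by now apply (ord_down a Ha m).
      destruct (Hmin x) as [K|K].
      * apply (HD x). auto.
      * apply (ord_asym x m); auto. now apply (ord_mem a).
      * subst. now apply (ord_mem_irrefl a Ha x).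
    + intros Hx. destruct (ord_mem_total a Ha x m) as [K|[K|K]]; auto.
      * now subst.
      * exfalso. apply Hmc. now apply (Ht x).
  - left. apply cls_eq; [exact Hc|now apply ord_cls|]. intros x. split; [apply Hca|].
    intros Hx. apply NNPP. intros N. apply HN. exists x. apply (HD x). auto.
Qed.

(** The intersection is a segment of both. It equals one of them, for otherwise it would be a member
    of both and so of itself. *)
Lemma ord_total a b : ord a -> ord b -> a ∈+ b \/ a = b \/ b ∈+ a.
Proof.
  intros Ha Hb. destruct (collect (fun x => x ∈+ a /\ x ∈+ b)) as [c Hc].
  { red. dfn. } { exists a. tauto. }
  assert (K : forall x y, x ∈+ c -> y ∈+ x -> y ∈+ c).
  { intros x y Hx Hy. apply (Hc x) in Hx as [H1 H2]. apply (Hc y).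
    split; eapply ord_down; eauto. }
  destruct (ord_segment a c) as [E|Ea]; auto.
  { now apply (collects_cls _ _ Hc). } { intros x Hx. now apply (Hc x) in Hx. }
  - destruct (ord_segment b c) as [E'|Eb]; auto.
    { now apply (collects_cls _ _ Hc). } { intros x Hx. now apply (Hc x) in Hx. }
    + right. left. congruence.
    + left. congruence.
  - destruct (ord_segment b c) as [E'|Eb]; auto.
    { now apply (collects_cls _ _ Hc). } { intros x Hx. now apply (Hc x) in Hx. }
    + right. right. congruence.
    + exfalso. apply (ord_irrefl c); [now apply (ord_mem a)|]. apply (Hc c). auto.
Qed.

Lemma ord_of_ordinals o : cls o -> (forall x, x ∈+ o -> ord x) ->
  (forall x y, x ∈+ o -> y ∈+ x -> y ∈+ o) -> ord o.
Proof.
  intros Ho HO HD. split; auto.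
  - intros x Hx. now apply ord_cls, HO.
  - intros x Hx. now apply ord_irrefl, HO.
  - intros x y z Hx Hy Hz Hxy Hyz. apply (ord_down z (HO z Hz) y); auto.
  - intros x y Hx Hy. apply ord_total; auto.
  - intros S HS HSo [s Hs]. destruct (collect (fun x => x ∈+ S /\ x ∈+ s)) as [T HT].
    { red. dfn. } { exists S. tauto. }
    assert (Os : ord s) by auto.
    destruct (classic (exists x, x ∈+ T)) as [HN|HN].
    + destruct (ord_min s Os T) as (m & Hm & Hmin); auto.
      { now apply (collects_cls _ _ HT). } { intros x Hx. now apply (HT x) in Hx. }
      apply (HT m) in Hm as [HmS Hms]. exists m. split; [exact HmS|]. intros x Hx.
      destruct (ord_total m x) as [K|[K|K]]; auto. apply Hmin, (HT x). split; [exact Hx|].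
      now apply (ord_down s Os m).
    + exists s. split; [exact Hs|]. intros x Hx.
      destruct (ord_total s x) as [K|[K|K]]; auto. exfalso. apply HN. exists x. apply (HT x). auto.
Qed.

Lemma ord_succ a : ord a -> exists s, ord s /\ forall x, x ∈+ s <-> x ∈+ a \/ x = a.
Proof.
  intros Ha. destruct (collect (fun x => x ∈+ a \/ x = a)) as [s Hs].
  { red. dfn. } { apply bounded_or; [apply bounded_in|apply bounded_eq]. }
  exists s. split; [|apply Hs]. apply ord_of_ordinals.
  - now apply (collects_cls _ _ Hs).
  - intros x Hx. apply (Hs x) in Hx as [Hx| ->]; [now apply (ord_mem a)|exact Ha].
  - intros x y Hx Hy. apply (Hs y). left.
    apply (Hs x) in Hx as [Hx| ->]; [now apply (ord_down a Ha x)|exact Hy].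
Qed.

Lemma ord_least (P : M -> Prop) a : definable1 P -> ord a -> P a ->
  exists m, ord m /\ P m /\ forall b, ord b -> P b -> m ∈+ b \/ m = b.
Proof.
  intros D Ha Pa. destruct (ord_succ a Ha) as (s & Os & Hs).
  destruct (collect (fun x => x ∈+ s /\ P x)) as [S HS].
  { red. dfn. } { exists s. tauto. }
  destruct (ord_min s Os S) as (m & Hm & Hmin).
  - now apply (collects_cls _ _ HS).
  - intros x Hx. now apply (HS x) in Hx.
  - exists a. apply (HS a). split; [apply Hs; auto|exact Pa].
  - apply (HS m) in Hm as [Hms Pm]. assert (Om : ord m) by now apply (ord_mem s).
    exists m. split; [exact Om|split; [exact Pm|]]. intros b Ob Pb.
    destruct (ord_total m b) as [K|[K|K]]; auto. apply Hmin, (HS b). split; [|exact Pb].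
    now apply (ord_down s Os m).
Qed.

Lemma ord_ind (P : M -> Prop) : definable1 P ->
  (forall a, ord a -> (forall b, b ∈+ a -> P b) -> P a) -> forall a, ord a -> P a.
Proof.
  intros D H a Ha. apply NNPP. intros N.
  destruct (ord_least (fun x => ~ P x) a) as (m & Om & Nm & Hm); auto.
  { red. dfn. }
  apply Nm, H; [exact Om|]. intros b Hb. apply NNPP. intros Nb.
  assert (Ob : ord b) by now apply (ord_mem m).
  destruct (Hm b Ob Nb) as [K| ->].
  - now apply (ord_asym m b).
  - now apply (ord_irrefl b).
Qed.

(** The order type is reached by the recursion [g(b) = f(X \ g[b])], [f] a
    choice function for the non-empty subsets of [X]; were it never to exhaust
    [X], Replacement along the inverse of [g] would make all ordinals a set. *)
Lemma well_ordering X : cls X -> exists o, ord o /\ equipotent X o.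
Proof.
  intros HX.
  destruct (collect (fun u => (cls u /\ (forall x, x ∈+ u -> x ∈+ X)) /\ exists x, x ∈+ u))
    as [U HU].
  { unfold cls. red. dfn. }
  { apply (bounded_sub _ (fun u => cls u /\ (forall x, x ∈+ u -> x ∈+ X))); [tauto|].
    now apply power_bound. }
  destruct (choice U) as (f & (Hc & _ & Hfun) & Hdom & Hpick).
  { now apply (collects_cls _ _ HU). } { intros u Hu. now apply (HU u) in Hu. }
  apply is_classical_iff in Hc. apply is_dom_iff in Hdom; [|exact Hc].
  assert (pick_fun : forall u x y, pair_mem u x f -> pair_mem u y f -> x = y).
  { intros u x y H K. now apply (Hfun u x y). }
  (* [u] is the classical set X \ g[b]. Classicality determines [u] completely, so the choice
     function is applied to a definite argument. *)
  set (rest := fun g b u => forall y,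
    (y ∈+ u <-> ~ y ∈- u) /\ (y ∈+ u <-> y ∈+ X /\ ~ exists c, c ∈+ b /\ pair_mem c y g)).
  assert (rest_ex : forall g b, exists u, rest g b u).
  { intros g b.
    destruct (collect (fun y => y ∈+ X /\ ~ exists c, c ∈+ b /\ pair_mem c y g)) as [u Hu].
    - red. dfn.
    - exists X. tauto.
    - exists u. intros y. split; [apply (collects_cls _ _ Hu)|apply (Hu y)]. }
  assert (rest_ext : forall g g' b u,
    (forall c y, c ∈+ b -> (pair_mem c y g <-> pair_mem c y g')) -> rest g b u -> rest g' b u).
  { intros g g' b u H K y. destruct (K y) as [K1 K2]. split; [exact K1|]. rewrite K2.
    split; intros [Hy N]; (split; [exact Hy|]); intros (c & H1 & H2); apply N; exists c;
      (split; [exact H1|]); now apply (H c y). }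
  (* [g] is an attempt: the recursion carried out on the ordinal [a]. As f has only non-empty sets
     in its domain, an attempt never passes the point where [X] is exhausted. [is_ordinal] is used
     because [dfn] can take it apart, unlike the record [ord]. *)
  set (att := fun a g => is_ordinal a /\ (forall b x, pair_mem b x g -> b ∈+ a) /\
    (forall b, b ∈+ a -> exists x, pair_mem b x g) /\
    (forall b x u, pair_mem b x g -> rest g b u -> pair_mem u x f)).
  assert (att_ord : forall a g b, att a g -> b ∈+ a -> ord b).
  { intros a g b (Ha & _) Hb. apply is_ordinal_iff in Ha. now apply (ord_mem a). }
  assert (att_down : forall a g b c, att a g -> b ∈+ a -> c ∈+ b -> c ∈+ a).
  { intros a g b c (Ha & _) Hb. apply is_ordinal_iff in Ha. now apply (ord_down a). }
  assert (coherent : forall a g a' g', att a g -> att a' g' -> forall b, ord b ->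
    b ∈+ a -> b ∈+ a' -> forall x, pair_mem b x g <-> pair_mem b x g').
  { intros a g a' g' Hg Hg'.
    apply (ord_ind (fun b => b ∈+ a -> b ∈+ a' -> forall x, pair_mem b x g <-> pair_mem b x g')).
    { red. dfn. }
    intros b Ob IH Ha Ha' x. destruct (rest_ex g b) as [u Hu].
    assert (Hu' : rest g' b u).
    { apply (rest_ext g); [|exact Hu]. intros c y Hc'. apply IH; eauto. }
    destruct Hg as (_ & _ & Tg & Rg), Hg' as (_ & _ & Tg' & Rg').
    destruct (Tg b Ha) as [y Hy], (Tg' b Ha') as [y' Hy'].
    assert (E : forall x y, pair_mem b x g -> pair_mem b y g' -> x = y).
    { intros x1 x2 H1 H2. apply (pick_fun u); eauto. }
    split; intros H; [rewrite (E x y')|rewrite <- (E y x)]; auto. }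
  set (F := fun b x => exists a g, att a g /\ pair_mem b x g).
  assert (F_definable : definable2 F).
  { subst F att rest. unfold is_ordinal, is_classical. red. dfn. }
  assert (F_att : forall a g b x, att a g -> b ∈+ a -> (F b x <-> pair_mem b x g)).
  { intros a g b x Hg Hb. split; [|intros H; exists a, g; auto].
    intros (a' & g' & Hg' & H). apply (coherent a' g' a g); eauto.
    apply Hg' in H. exact H. }
  assert (F_pick : forall b x, F b x -> exists u, pair_mem u x f /\
    forall y, y ∈+ u <-> y ∈+ X /\ ~ exists c, c ∈+ b /\ F c y).
  { intros b x (a & g & Hg & H). destruct (rest_ex g b) as [u Hu]. exists u.
    pose proof Hg as (Oa & Da & Ta & Ra). split; [eauto|]. intros y. rewrite (proj2 (Hu y)).
    split; intros [Hy N]; (split; [exact Hy|]); intros (c & H1 & H2); apply N; exists c;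
      (split; [exact H1|]); apply (F_att a g); eauto. }
  assert (F_X : forall b x, F b x -> x ∈+ X /\ ~ exists c, c ∈+ b /\ F c x).
  { intros b x H. destruct (F_pick b x H) as (u & Hu & Hr). apply Hr. now apply Hpick. }
  assert (F_fun : forall b x y, F b x -> F b y -> x = y).
  { intros b x y Hx Hy. destruct (F_pick b x Hx) as (u & Hu & Ku).
    destruct (F_pick b y Hy) as (v & Hv & Kv).
    apply (pick_fun u); [exact Hu|]. replace u with v; [exact Hv|].
    apply cls_eq.
    - apply (HU v), Hdom. eauto.
    - apply (HU u), Hdom. eauto.
    - intros z. now rewrite Ku, Kv. }
  assert (F_ord : forall b x, F b x -> ord b).
  { intros b x (a & g & Hg & H). apply (att_ord a g); auto. now apply Hg in H. }
  assert (F_inj : forall b c x, F b x -> F c x -> b = c).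
  { intros b c x Hb Hc'. destruct (ord_total b c) as [K|[K|K]]; eauto; exfalso.
    - apply (F_X c x Hc'). eauto.
    - apply (F_X b x Hb). eauto. }
  destruct (replacement (fun x b => F b x) X) as [o Ho].
  { intros s t Hs Ht. now apply F_definable. } { intros x b c _. apply F_inj. }
  assert (o_iff : forall b, b ∈+ o <-> exists x, F b x).
  { intros b. rewrite (collects_in _ _ b Ho). split; [intros (x & _ & H); eauto|].
    intros [x H]. exists x. split; [apply (F_X b x H)|exact H]. }
  assert (Oo : ord o).
  { apply ord_of_ordinals.
    - now apply (collects_cls _ _ Ho).
    - intros b Hb. apply o_iff in Hb as [x H]. eauto.
    - intros b c Hb Hc'. apply o_iff in Hb as (x & a & g & Hg & H). apply o_iff.
      assert (Ha : c ∈+ a) by (apply (att_down a g b); auto; now apply Hg in H).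
      destruct Hg as (O & D & T & R). destruct (T c Ha) as [y Hy]. exists y, a, g.
      split; [split; auto|exact Hy]. }
  exists o. split; [exact Oo|]. apply equipotent_sym.
  destruct (embedding_set F o X) as (h & Hh & Kh); auto.
  { intros b Hb. now apply o_iff. }
  { intros b x _ H. now apply (F_X b). }
  { intros b x y _. apply F_fun. }
  { intros b c x _ _. apply F_inj. }
  exists h. split; [exact Hh|]. intros y Hy. apply NNPP. intros N.
  destruct (rest_ex h o) as [u Hu].
  assert (Hne : u ∈+ U).
  { apply (HU u). split; [split|].
    - intros z. apply Hu.
    - intros z Hz. now apply (proj2 (Hu z)) in Hz.
    - exists y. apply (Hu y). split; [exact Hy|]. intros (c & H1 & H2). apply N. eauto. }
  apply (Hdom u) in Hne as [x0 Hx0].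
  (* [F] together with the pair of [o] and [x0] is an attempt on the successor of [o]. This puts [o]
     into the domain of [F], which is [o] itself. *)
  destruct (ord_succ o Oo) as (s & Os & Hs).
  destruct (relation_set (fun b x => F b x \/ (b = o /\ x = x0)) s) as (g & _ & _ & Hg).
  { red. dfn. }
  { intros b x z _ [H|[-> ->]] [K|[E ->]]; eauto.
    - exfalso. subst. apply (ord_irrefl o Oo). apply o_iff. eauto.
    - exfalso. apply (ord_irrefl o Oo). apply o_iff. eauto. }
  assert (g_below : forall b x, b ∈+ o -> (pair_mem b x g <-> F b x)).
  { intros b x Hb. rewrite Hg, Hs. split; [|tauto].
    intros [_ [H|[-> _]]]; [exact H|]. now apply ord_irrefl in Hb. }
  apply (ord_irrefl o Oo). apply o_iff. exists x0, s, g. split.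
  - split; [now apply is_ordinal_iff|]. split; [|split].
    + intros b x H. now apply Hg in H.
    + intros b Hb. pose proof Hb as Hb'. apply Hs in Hb' as [Hb'| ->].
      * apply o_iff in Hb' as [x H]. exists x. apply Hg. auto.
      * exists x0. apply Hg. auto.
    + intros b x v H Hv. apply Hg in H as [_ [H|[-> ->]]].
      * destruct (F_pick b x H) as (w & Hw & Kw). replace v with w; [exact Hw|].
        assert (Hb : b ∈+ o) by (apply o_iff; eauto).
        apply cls_eq; [apply (HU w), Hdom; eauto|intros z; apply Hv|].
        intros z. rewrite Kw, (proj2 (Hv z)).
        split; intros [Hz K]; (split; [exact Hz|]); intros (c & H1 & H2); apply K; exists c;
          (split; [exact H1|]); apply (g_below c z); auto; now apply (ord_down o Oo b).
      * replace v with u; [exact Hx0|]. apply cls_eq; [intros z; apply Hu|intros z; apply Hv|].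
        intros z. rewrite (proj2 (Hu z)), (proj2 (Hv z)).
        split; intros [Hz K]; (split; [exact Hz|]); intros (c & H1 & H2); apply K; exists c;
          (split; [exact H1|]).
        -- apply Kh. split; [exact H1|]. now apply g_below.
        -- apply g_below; [exact H1|]. now apply Kh in H2.
  - apply Hg. split; [apply Hs|]; auto.
Qed.

(** * Cardinals of classical sets *)

Lemma is_card_cl_iff X k : cls X ->
  (is_card_cl X k <->
    (ord k /\ equipotent X k) /\ forall b, ord b -> equipotent X b -> k ∈+ b \/ k = b).
Proof.
  intros HX. unfold is_card_cl. split.
  - intros (H1 & H2 & H3). apply is_ordinal_iff in H1.
    apply is_bijective_iff in H2; [|auto|now apply ord_cls]. split; [auto|].
    intros b Hb K. apply H3. split; [now apply is_ordinal_iff|].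
    apply is_bijective_iff; auto. now apply ord_cls.
  - intros ([H1 H2] & H3). split; [now apply is_ordinal_iff|]. split.
    + apply is_bijective_iff; auto. now apply ord_cls.
    + intros b [Hb K]. apply is_ordinal_iff in Hb. apply H3; [exact Hb|].
      apply is_bijective_iff; auto. now apply ord_cls.
Qed.

Lemma card_cl_ex X : cls X -> exists k, is_card_cl X k.
Proof.
  intros HX. destruct (well_ordering X HX) as (o & Oo & Ho).
  destruct (ord_least (fun b => equipotent X b) o) as (k & Ok & Hk & Hmin); auto.
  - unfold equipotent, bijects. red. intros s Hs.
    (* The record [embeds] is spelled out as a conjunction, since [dfn] does not look into
       records. *)
    apply (definable_iff (fun e => exists f,
      (((forall x, x ∈+ X -> exists y, pair_mem x y f) /\
       (forall x y, x ∈+ X -> pair_mem x y f -> y ∈+ s e)) /\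
       (forall x y z, x ∈+ X -> pair_mem x y f -> pair_mem x z f -> y = z) /\
       (forall x x' y, x ∈+ X -> x' ∈+ X -> pair_mem x y f -> pair_mem x' y f -> x = x')) /\
       (forall y, y ∈+ s e -> exists x, x ∈+ X /\ pair_mem x y f))).
    + intros e. split.
      * intros (f & ((H1 & H2) & H3 & H4) & H5). exists f. split; [split|]; auto.
      * intros (f & [H1 H2 H3 H4] & H5). exists f. split; [split|]; auto.
    + dfn.
  - exists k. apply is_card_cl_iff; auto.
Qed.

Lemma card_cl_ord X k : cls X -> is_card_cl X k -> ord k.
Proof. intros HX H. apply is_card_cl_iff in H; tauto. Qed.

Lemma card_cl_eq X Y k l : cls X -> cls Y -> is_card_cl X k -> is_card_cl Y l ->
  (k = l <-> equipotent X Y).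
Proof.
  intros HX HY Hk Hl. apply is_card_cl_iff in Hk as [[Ok Hk] Mk]; [|exact HX].
  apply is_card_cl_iff in Hl as [[Ol Hl] Ml]; [|exact HY]. split.
  - intros <-. apply (equipotent_trans _ k); [exact Hk|now apply equipotent_sym].
  - intros H. destruct (Mk l Ol) as [K|K]; [now apply (equipotent_trans _ Y)| |exact K].
    destruct (Ml k Ok) as [K'|K']; [|exfalso; now apply (ord_asym k l)|now symmetry].
    apply (equipotent_trans _ X); [now apply equipotent_sym|exact Hk].
Qed.

(** In the critical case [l] ∈ [k], the inclusion of [l] in [k] embeds [Y] into [X];
    Cantor-Bernstein then makes [X] and [Y] equipotent, and minimality gives [k] = [l]. *)
Lemma card_cl_le X Y k l : cls X -> cls Y -> is_card_cl X k -> is_card_cl Y l ->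
  ((forall x, x ∈+ k -> x ∈+ l) <-> exists f, embeds f X Y).
Proof.
  intros HX HY Hk Hl. pose proof (card_cl_eq X Y k l HX HY Hk Hl) as E.
  apply is_card_cl_iff in Hk as [[Ok Hk] Mk]; [|exact HX].
  apply is_card_cl_iff in Hl as [[Ol Hl] Ml]; [|exact HY]. split.
  - intros H. destruct (equipotent_embeds _ _ Hk) as [f Hf].
    destruct (embeds_sub k l H) as [g Hg].
    destruct (equipotent_embeds _ _ (equipotent_sym _ _ Hl)) as [h Hh].
    destruct (embeds_trans _ _ _ _ _ Hf Hg) as [f' Hf'].
    exact (embeds_trans _ _ _ _ _ Hf' Hh).
  - intros [f Hf] x Hx. destruct (ord_total k l Ok Ol) as [K|[<-|K]].
    + now apply (ord_down l Ol k).
    + exact Hx.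
    + assert (Hg : exists g, embeds g Y X).
      { destruct (equipotent_embeds _ _ Hl) as [g1 H1].
        destruct (embeds_sub l k) as [g2 H2]; [intros z; now apply (ord_down k Ok l)|].
        destruct (equipotent_embeds _ _ (equipotent_sym _ _ Hk)) as [g3 H3].
        destruct (embeds_trans _ _ _ _ _ H1 H2) as [g4 H4].
        exact (embeds_trans _ _ _ _ _ H4 H3). }
      destruct Hg as [g Hg]. apply (cantor_bernstein f g) in Hf; [|exact Hg].
      apply E in Hf. now subst.
Qed.

End Ordinals.

(** * Cardinal numbers and countings *)

Section Cardinals.
Context {M : model} {HM : bzfc_model M}.
Implicit Types (A B P Q X Y Z U a b c d k l x y z p q f g h u v w : carrier M).

Lemma pos_ex A : exists P, is_pos A P.
Proof.
  destruct (collect (fun x => x ∈+ A)) as [P HP]; [red; dfn|apply bounded_in|].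
  exists P. now apply is_pos_iff.
Qed.

Lemma pot_ex A : exists P, is_pot A P.
Proof.
  destruct (collect (fun x => ~ x ∈- A)) as [P HP]; [red; dfn|apply bounded_pot|].
  exists P. now apply is_pot_iff.
Qed.

Lemma part_iff A U (Th Fh : M -> M -> M -> Prop) (K : M -> Prop) :
  (forall P Q, collects P (fun x => x ∈+ A) -> collects Q (fun x => ~ x ∈- A) ->
    forall x, (Th P Q x <-> K x) /\ (Fh P Q x <-> ~ K x)) ->
  (exists P, is_pos A P /\ exists Q, is_pot A Q /\ is_set_of (Th P Q) (Fh P Q) U) <-> collects U K.
Proof.
  intros H. split.
  - intros (P & HP & Q & HQ & HU). apply is_pos_iff in HP. apply is_pot_iff in HQ.
    intros x. destruct (HU x), (H P Q HP HQ x). tauto.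
  - intros HU. destruct (pos_ex A) as [P HP], (pot_ex A) as [Q HQ].
    exists P. split; [exact HP|]. exists Q. split; [exact HQ|].
    apply is_pos_iff in HP. apply is_pot_iff in HQ.
    intros x. destruct (HU x), (H P Q HP HQ x). tauto.
Qed.

Ltac part := unfold is_both_part, is_true_part, is_neither_part, is_rlm;
  apply part_iff; intros P Q HP HQ x; specialize (HP x); specialize (HQ x); tauto.

Lemma is_both_part_iff A U : is_both_part A U <-> collects U (fun x => x ∈+ A /\ x ∈- A).
Proof. part. Qed.

Lemma is_true_part_iff A U : is_true_part A U <-> collects U (fun x => x ∈+ A /\ ~ x ∈- A).
Proof. part. Qed.

Lemma is_neither_part_iff A U :
  is_neither_part A U <-> collects U (fun x => ~ x ∈- A /\ ~ x ∈+ A).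
Proof. part. Qed.

Lemma is_rlm_iff A U : is_rlm A U <-> collects U (fun x => x ∈+ A \/ ~ x ∈- A).
Proof. part. Qed.

Record parts A P Q T B N : Prop := {
  parts_pos : collects P (fun x => x ∈+ A);
  parts_pot : collects Q (fun x => ~ x ∈- A);
  parts_true : collects T (fun x => x ∈+ A /\ ~ x ∈- A);
  parts_both : collects B (fun x => x ∈+ A /\ x ∈- A);
  parts_neither : collects N (fun x => ~ x ∈- A /\ ~ x ∈+ A) }.

Lemma parts_ex A : exists P Q T B N, parts A P Q T B N.
Proof.
  destruct (collect (fun x => x ∈+ A)) as [P HP]; [red; dfn|apply bounded_in|].
  destruct (collect (fun x => ~ x ∈- A)) as [Q HQ]; [red; dfn|apply bounded_pot|].
  destruct (collect (fun x => x ∈+ A /\ ~ x ∈- A)) as [T HT]; [red; dfn|exists A; tauto|].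
  destruct (collect (fun x => x ∈+ A /\ x ∈- A)) as [B HB]; [red; dfn|exists A; tauto|].
  destruct (collect (fun x => ~ x ∈- A /\ ~ x ∈+ A)) as [N HN]; [red; dfn| |].
  - apply (bounded_sub _ (fun x => ~ x ∈- A)); [tauto|apply bounded_pot].
  - exists P, Q, T, B, N. now split.
Qed.

Lemma rlm_ex A : exists R, is_rlm A R.
Proof.
  destruct (collect (fun x => x ∈+ A \/ ~ x ∈- A)) as [R HR].
  - red. dfn.
  - apply bounded_or; [apply bounded_in|apply bounded_pot].
  - exists R. now apply is_rlm_iff.
Qed.

Lemma is_angle_iff X Y W : cls X -> cls Y ->
  (is_angle X Y W <-> forall x, (x ∈+ W <-> x ∈+ X) /\ (x ∈- W <-> ~ x ∈+ Y)).
Proof.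
  intros HX HY. unfold is_angle. rewrite is_pos_iff, is_pot_iff. split.
  - intros [H K] x. specialize (H x). specialize (K x). tauto.
  - intros H. split; intros x; specialize (H x); specialize (HX x); specialize (HY x); tauto.
Qed.

Lemma is_angle_ex X Y : cls X -> cls Y -> exists W, is_angle X Y W.
Proof.
  intros HX HY. destruct (angle_ex (fun x => x ∈+ X) (fun x => x ∈+ Y)) as [W HW].
  1,2: red; dfn.
  1,2: apply bounded_in.
  exists W. now apply is_angle_iff.
Qed.

Lemma is_angle_eq X Y X' Y' W W' : cls X -> cls Y -> cls X' -> cls Y' ->
  is_angle X Y W -> is_angle X' Y' W' -> (W = W' <-> X = X' /\ Y = Y').
Proof.
  intros HX HY HX' HY' H H'. rewrite is_angle_iff in H, H' by assumption. split.
  - intros <-. split; apply cls_eq; auto; intros x; specialize (H x); specialize (H' x); tauto.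
  - intros [<- <-]. apply set_eq. intros x. specialize (H x). specialize (H' x). tauto.
Qed.

(** A witness of the disequality is true in one set and false in the other, so it lies in [X] but
    not in [Y'], or in [X'] but not in [Y]. *)
Lemma is_angle_eq_neg X Y X' Y' W W' : cls X -> cls Y -> cls X' -> cls Y' ->
  is_angle X Y W -> is_angle X' Y' W' ->
  (eq_neg M W W' <-> ~ ((forall x, x ∈+ X -> x ∈+ Y') /\ (forall x, x ∈+ X' -> x ∈+ Y))).
Proof.
  intros HX HY HX' HY' H H'. rewrite is_angle_iff in H, H' by assumption.
  rewrite eq_neg_iff. split.
  - intros [x Hx] [K K']. specialize (H x). specialize (H' x). specialize (K x).
    specialize (K' x). tauto.
  - intros N. apply NNPP. intros C. apply N. split; intros x Hx; apply NNPP; intros Nx;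
      apply C; exists x; specialize (H x); specialize (H' x); tauto.
Qed.

Lemma card_ex A : exists k, is_card A k.
Proof.
  destruct (parts_ex A) as (P & Q & T & B & N & [HP HQ HT HB HN]).
  destruct (card_cl_ex P) as [c1 H1]; [now apply (collects_cls _ _ HP)|].
  destruct (card_cl_ex Q) as [c2 H2]; [now apply (collects_cls _ _ HQ)|].
  destruct (card_cl_ex T) as [ct Ht]; [now apply (collects_cls _ _ HT)|].
  destruct (card_cl_ex B) as [cb Hb]; [now apply (collects_cls _ _ HB)|].
  destruct (card_cl_ex N) as [cn Hn]; [now apply (collects_cls _ _ HN)|].
  assert (O : forall U (K : M -> Prop) c, collects U K -> is_card_cl U c -> cls c).
  { intros U K c HU Hc. apply ord_cls, (card_cl_ord U); [now apply (collects_cls _ _ HU)|exact Hc]. }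
  destruct (is_angle_ex c1 c2) as [X HX]; eauto.
  destruct (is_angle_ex ct c2) as [Y HY]; eauto.
  destruct (is_angle_ex cb cn) as [Z HZ]; eauto.
  destruct (opair_ex X Y) as [p Hp]. destruct (opair_ex p Z) as [k Hk].
  exists k. unfold is_card, is_triple.
  exists P; split; [now apply is_pos_iff|]. exists Q; split; [now apply is_pot_iff|].
  exists T; split; [now apply is_true_part_iff|]. exists B; split; [now apply is_both_part_iff|].
  exists N; split; [now apply is_neither_part_iff|].
  eauto 20.
Qed.

Lemma is_triple_eq a b c a' b' c' t t' : is_triple a b c t -> is_triple a' b' c' t' ->
  (t = t' <-> a = a' /\ b = b' /\ c = c').
Proof.
  intros (p & Hp & Ht) (p' & Hp' & Ht'). split.
  - intros <-. destruct (opair_inj _ _ _ _ _ Ht Ht') as [<- <-].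
    destruct (opair_inj _ _ _ _ _ Hp Hp') as [<- <-]. auto.
  - intros (<- & <- & <-). rewrite (opair_unique _ _ _ _ Hp' Hp) in Ht'.
    apply (opair_unique _ _ _ _ Ht Ht').
Qed.

Lemma is_triple_eq_neg a b c a' b' c' t t' : is_triple a b c t -> is_triple a' b' c' t' ->
  (eq_neg M t t' <-> eq_neg M a a' \/ eq_neg M b b' \/ eq_neg M c c').
Proof.
  intros (p & Hp & Ht) (p' & Hp' & Ht').
  rewrite (opair_eq_neg _ _ _ _ _ _ Ht Ht'), (opair_eq_neg _ _ _ _ _ _ Hp Hp'). tauto.
Qed.

Lemma card_compare A B k l P Q T D N P' Q' T' D' N' :
  parts A P Q T D N -> parts B P' Q' T' D' N' -> is_card A k -> is_card B l ->
  (k = l <-> equipotent P P' /\ equipotent Q Q' /\ equipotent T T' /\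
    equipotent D D' /\ equipotent N N') /\
  (eq_neg M k l <-> ~ ((exists f, embeds f P Q') /\ (exists f, embeds f P' Q) /\
    (exists f, embeds f D N') /\ (exists f, embeds f D' N))).
Proof.
  intros [HP HQ HT HD HN] [HP' HQ' HT' HD' HN']
    (P0 & EP & Q0 & EQ & T0 & ET & D0 & ED & N0 & EN & c1 & C1 & c2 & C2 & ct & Ct &
     cb & Cb & cn & Cn & X & HX & Y & HY & Z & HZ & Hk)
    (P0' & EP' & Q0' & EQ' & T0' & ET' & D0' & ED' & N0' & EN' & c1' & C1' & c2' & C2' & ct' & Ct' &
     cb' & Cb' & cn' & Cn' & X' & HX' & Y' & HY' & Z' & HZ' & Hl).
  apply is_pos_iff in EP, EP'. apply is_pot_iff in EQ, EQ'. apply is_true_part_iff in ET, ET'.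
  apply is_both_part_iff in ED, ED'. apply is_neither_part_iff in EN, EN'.
  assert (E : forall U U' (K : M -> Prop), collects U K -> collects U' K -> U' = U).
  { intros U U' K HU HU'. now apply (collects_unique _ _ _ _ HU' HU). }
  rewrite (E P P0 _ HP EP) in C1. rewrite (E P' P0' _ HP' EP') in C1'.
  rewrite (E Q Q0 _ HQ EQ) in C2. rewrite (E Q' Q0' _ HQ' EQ') in C2'.
  rewrite (E T T0 _ HT ET) in Ct. rewrite (E T' T0' _ HT' ET') in Ct'.
  rewrite (E D D0 _ HD ED) in Cb. rewrite (E D' D0' _ HD' ED') in Cb'.
  rewrite (E N N0 _ HN EN) in Cn. rewrite (E N' N0' _ HN' EN') in Cn'.
  clear - HM HP HQ HT HD HN HP' HQ' HT' HD' HN' C1 C2 Ct Cb Cn C1' C2' Ct' Cb' Cn'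
    HX HY HZ HX' HY' HZ' Hk Hl.
  assert (TP : forall x, x ∈+ T -> x ∈+ P) by (intros x Hx; apply (HP x); now apply (HT x) in Hx).
  assert (TP' : forall x, x ∈+ T' -> x ∈+ P') by (intros x Hx; apply (HP' x); now apply (HT' x) in Hx).
  apply collects_cls in HP, HQ, HT, HD, HN, HP', HQ', HT', HD', HN'.
  assert (O : forall U c, cls U -> is_card_cl U c -> cls c).
  { intros U c HU Hc. now apply ord_cls, (card_cl_ord U). }
  split.
  - rewrite (is_triple_eq _ _ _ _ _ _ _ _ Hk Hl).
    rewrite (is_angle_eq c1 c2 c1' c2' X X'), (is_angle_eq ct c2 ct' c2' Y Y'),
      (is_angle_eq cb cn cb' cn' Z Z') by eauto.
    rewrite (card_cl_eq P P'), (card_cl_eq Q Q'), (card_cl_eq T T'), (card_cl_eq D D'),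
      (card_cl_eq N N') by assumption.
    tauto.
  - rewrite (is_triple_eq_neg _ _ _ _ _ _ _ _ Hk Hl).
    rewrite (is_angle_eq_neg c1 c2 c1' c2' X X'), (is_angle_eq_neg ct c2 ct' c2' Y Y'),
      (is_angle_eq_neg cb cn cb' cn' Z Z') by eauto.
    rewrite (card_cl_le P Q'), (card_cl_le P' Q), (card_cl_le T Q'), (card_cl_le T' Q),
      (card_cl_le D N'), (card_cl_le D' N) by assumption.
    (* The second coordinates ask for embeddings of A_t into B^? and of B_t into A^?. These are
       restrictions of embeddings of A^! and B^!. *)
    assert (S : forall U V W, (forall x, x ∈+ U -> x ∈+ V) ->
      (exists f, embeds f V W) -> exists f, embeds f U W).
    { intros U V W HU [f Hf]. destruct (embeds_sub U V HU) as [g Hg].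
      exact (embeds_trans _ _ _ _ _ Hg Hf). }
    pose proof (S T P Q' TP). pose proof (S T' P' Q TP'). tauto.
Qed.

Lemma card_unique A k k' : is_card A k -> is_card A k' -> k = k'.
Proof.
  intros H H'. destruct (parts_ex A) as (P & Q & T & D & N & HA).
  apply (card_compare A A k k' _ _ _ _ _ _ _ _ _ _ HA HA H H').
  repeat split; apply equipotent_refl.
Qed.

(** * Countings and their images *)

Lemma is_count_iff A f : is_count A f <-> is_injection f /\
  forall x, (exists y, pair_mem x y f) <-> (x ∈+ A \/ ~ x ∈- A).
Proof.
  split.
  - intros [Hi (R & HR & Hd)]. split; [exact Hi|]. apply is_rlm_iff in HR.
    apply is_dom_iff in Hd; [|apply is_classical_iff, Hi].
    intros x. rewrite <- (collects_in _ _ x Hd). apply (HR x).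
  - intros [Hi H]. split; [exact Hi|]. destruct (rlm_ex A) as [R HR]. exists R.
    split; [exact HR|]. apply is_rlm_iff in HR.
    apply is_dom_iff; [apply is_classical_iff, Hi|]. intros x. rewrite H. apply HR.
Qed.

Lemma count_ex (R : M -> M -> Prop) A : definable2 R ->
  (forall x, x ∈+ A \/ ~ x ∈- A -> exists y, R x y) ->
  (forall x y z, R x y -> R x z -> y = z) ->
  (forall x x' y, R x y -> R x' y -> x = x') ->
  exists f, is_count A f /\ forall x y, pair_mem x y f <-> (x ∈+ A \/ ~ x ∈- A) /\ R x y.
Proof.
  intros D HT HF HI. destruct (rlm_ex A) as [U HU]. apply is_rlm_iff in HU.
  destruct (embedding_injection R U) as (f & Hi & Hd & Hf).
  - now apply (collects_cls _ _ HU).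
  - exact D.
  - intros x Hx. apply HT, (HU x), Hx.
  - eauto.
  - eauto.
  - exists f. split.
    + split; [exact Hi|]. exists U. split; [now apply is_rlm_iff|exact Hd].
    + intros x y. rewrite Hf, (collects_in _ _ x HU). tauto.
Qed.

Lemma image_ex A f : is_count A f -> exists u, is_image f A u.
Proof.
  intros Hf. apply is_count_iff in Hf as [[[_ [_ Hfun]] _] Hd].
  destruct (rlm_ex A) as [R HR]. apply is_rlm_iff in HR.
  destruct (replacement (fun x y => pair_mem x y f) R) as [C HC].
  { red. dfn. } { intros x y z _ H K. now apply (Hfun x y z). }
  assert (B : bounded (fun y => exists x, pair_mem x y f)).
  { exists C. intros y [x Hx]. apply (HC y). exists x. split; [|exact Hx].
    apply (HR x), Hd. eauto. }
  destruct (angle_ex (fun y => exists x, pair_mem x y f /\ x ∈+ A)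
    (fun y => exists x, pair_mem x y f /\ ~ x ∈- A)) as [u Hu].
  1,2: red; dfn.
  1,2: apply (bounded_sub _ (fun y => exists x, pair_mem x y f)); [|exact B].
  1,2: intros y (x & Hx & _); eauto.
  exists u. intros y. destruct (Hu y) as [-> ->]. split; [tauto|]. split.
  - intros N x Hx. apply NNPP. intros K. apply N. eauto.
  - intros H (x & Hx & K). auto.
Qed.

(** [a] and [b] are identified by countings [f] of [A] and [g] of [B]. *)
Definition glued f g a b : Prop := exists y, pair_mem a y f /\ pair_mem b y g.

Lemma glued_fun A f g B a b c : is_count A f -> is_count B g ->
  glued f g a b -> glued f g a c -> b = c.
Proof.
  intros Hf Hg (y & H1 & H2) (z & H3 & H4). apply is_count_iff in Hf as [[[_ [_ F]] _] _].
  apply is_count_iff in Hg as [[_ I] _].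
  destruct (F a y z) as [<- _]; [auto|]. now apply (I b c y).
Qed.

Lemma glued_sym f g a b : glued f g a b -> glued g f b a.
Proof. intros (y & H1 & H2). now exists y. Qed.

(** Gluing is functional and injective because both countings are, which leaves only totality and
    range to be checked. *)
Lemma glued_embeds A f B g X Y : is_count A f -> is_count B g ->
  (forall a, a ∈+ X -> exists b, glued f g a b /\ b ∈+ Y) -> exists h, embeds h X Y.
Proof.
  intros Hf Hg H.
  destruct (embedding_set (glued f g) X Y) as (h & Hh & _).
  - unfold glued. red. dfn.
  - intros a Ha. destruct (H a Ha) as (b & Hb & _). eauto.
  - intros a b Ha Hab. destruct (H a Ha) as (c & Hc & HY).
    now rewrite (glued_fun A f g B a b c).
  - intros a b c _ H1 H2. now apply (glued_fun A f g B a).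
  - intros a a' b _ _ H1 H2. apply (glued_fun B g f A b); auto using glued_sym.
  - eauto.
Qed.

(** The value f(a) lies in the realm of the common image, which is also the range of [g]; and [u]
    gives it the truth value that [a] has in [A] and its partner has in [B]. *)
Lemma image_eq_glued A B f g u : is_count A f -> is_count B g ->
  is_image f A u -> is_image g B u -> forall a, (a ∈+ A \/ ~ a ∈- A) ->
  exists b, glued f g a b /\ (a ∈+ A <-> b ∈+ B) /\ (a ∈- A <-> b ∈- B).
Proof.
  intros Hf Hg Hu Hv a Ha. pose proof Hf as Hf'. pose proof Hg as Hg'.
  apply is_count_iff in Hf as [[[_ [_ F]] I] Hd], Hg as [[[_ [_ G]] J] He].
  apply Hd in Ha as Hy. destruct Hy as [y Hy].
  assert (Ka : (y ∈+ u <-> a ∈+ A) /\ (y ∈- u <-> a ∈- A)).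
  { destruct (Hu y) as [-> ->]. split; split.
    - intros (x & Hx & K). now destruct (I a x y) as [-> _].
    - eauto.
    - auto.
    - intros K x Hx. now destruct (I x a y) as [-> _]. }
  assert (Hb : exists b, pair_mem b y g).
  { destruct Ha as [Ha|Ha].
    - apply Ka in Ha. apply Hv in Ha as (b & Hb & _). eauto.
    - apply NNPP. intros N. apply Ha, Ka, Hv. intros b Hb. exfalso. eauto. }
  destruct Hb as [b Hb].
  assert (Kb : (y ∈+ u <-> b ∈+ B) /\ (y ∈- u <-> b ∈- B)).
  { destruct (Hv y) as [-> ->]. split; split.
    - intros (x & Hx & K). now destruct (J b x y) as [-> _].
    - eauto.
    - auto.
    - intros K x Hx. now destruct (J x b y) as [-> _]. }
  exists b. split; [exists y; auto|]. tauto.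
Qed.

(** [K] selects a part by the truth and the falsity of membership, so one proof serves all five
    parts. Its first condition keeps the part inside the realm. *)
Lemma image_eq_equipotent A B f g u (K : Prop -> Prop -> Prop) X Y :
  is_count A f -> is_count B g -> is_image f A u -> is_image g B u ->
  (forall p q : Prop, K p q -> p \/ ~ q) ->
  (forall p q p' q' : Prop, (p <-> p') -> (q <-> q') -> (K p q <-> K p' q')) ->
  collects X (fun x => K (x ∈+ A) (x ∈- A)) -> collects Y (fun x => K (x ∈+ B) (x ∈- B)) ->
  equipotent X Y.
Proof.
  intros Hf Hg Hu Hv K1 K2 HX HY.
  destruct (glued_embeds A f B g X Y) as [h Hh]; auto.
  { intros a Ha. apply (HX a) in Ha.
    destruct (image_eq_glued A B f g u Hf Hg Hu Hv a (K1 _ _ Ha)) as (b & Hb & E1 & E2).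
    exists b. split; [exact Hb|]. apply (HY b). now apply (K2 _ _ _ _ E1 E2). }
  destruct (glued_embeds B g A f Y X) as [h' Hh']; auto.
  { intros b Hb. apply (HY b) in Hb.
    destruct (image_eq_glued B A g f u Hg Hf Hv Hu b (K1 _ _ Hb)) as (a & Ha & E1 & E2).
    exists a. split; [exact Ha|]. apply (HX a). now apply (K2 _ _ _ _ E1 E2). }
  exact (cantor_bernstein _ _ _ _ Hh Hh').
Qed.

(** The three bijections join to a map of rlm(A) onto rlm(B) that preserves truth values. It serves
    as the counting of [A], and the identity as that of [B]. *)
Lemma equal_images_of_equipotent A B P Q T D N P' Q' T' D' N' :
  parts A P Q T D N -> parts B P' Q' T' D' N' ->
  equipotent T T' -> equipotent D D' -> equipotent N N' ->
  exists f, is_count A f /\ exists g, is_count B g /\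
    exists u, is_image f A u /\ is_image g B u.
Proof.
  intros [HP HQ HT HD HN] [HP' HQ' HT' HD' HN']
    (i & [iT iR iF iI] & iS) (j & [jT jR jF jI] & jS) (h & [hT hR hF hI] & hS).
  set (G := fun a b => (a ∈+ T /\ pair_mem a b i) \/ (a ∈+ D /\ pair_mem a b j) \/
    (a ∈+ N /\ pair_mem a b h)).
  assert (val : forall a b, G a b -> (a ∈+ A <-> b ∈+ B) /\ (a ∈- A <-> b ∈- B)).
  { intros a b [[Ha H]|[[Ha H]|[Ha H]]].
    - specialize (iR a b Ha H). apply (HT a) in Ha. apply (HT' b) in iR. tauto.
    - specialize (jR a b Ha H). apply (HD a) in Ha. apply (HD' b) in jR. tauto.
    - specialize (hR a b Ha H). apply (HN a) in Ha. apply (HN' b) in hR. tauto. }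
  assert (T_iff : forall a, a ∈+ T <-> a ∈+ A /\ ~ a ∈- A) by (intros a; apply (HT a)).
  assert (D_iff : forall a, a ∈+ D <-> a ∈+ A /\ a ∈- A) by (intros a; apply (HD a)).
  assert (N_iff : forall a, a ∈+ N <-> ~ a ∈- A /\ ~ a ∈+ A) by (intros a; apply (HN a)).
  destruct (count_ex G A) as (f & Hf & Kf).
  { subst G. red. dfn. }
  { intros a Ha. destruct (classic (a ∈+ A)) as [H1|H1], (classic (a ∈- A)) as [H2|H2].
    - destruct (jT a) as [b Hb]; [apply D_iff; auto|]. exists b. right. left.
      rewrite D_iff. auto.
    - destruct (iT a) as [b Hb]; [apply T_iff; auto|]. exists b. left. rewrite T_iff. auto.
    - tauto.
    - destruct (hT a) as [b Hb]; [apply N_iff; auto|]. exists b. right. right.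
      rewrite N_iff. auto. }
  { intros a b c H K.
    destruct H as [[Ha H]|[[Ha H]|[Ha H]]], K as [[Ka K]|[[Ka K]|[Ka K]]]; eauto;
      exfalso; rewrite ?T_iff, ?D_iff, ?N_iff in Ha; rewrite ?T_iff, ?D_iff, ?N_iff in Ka; tauto. }
  { intros a a' b H K.
    assert (E : (a ∈+ A <-> a' ∈+ A) /\ (a ∈- A <-> a' ∈- A)).
    { pose proof (val a b H). pose proof (val a' b K). tauto. }
    destruct H as [[Ha H]|[[Ha H]|[Ha H]]], K as [[Ka K]|[[Ka K]|[Ka K]]]; eauto;
      exfalso; rewrite ?T_iff, ?D_iff, ?N_iff in Ha; rewrite ?T_iff, ?D_iff, ?N_iff in Ka; tauto. }
  assert (onto : forall b, b ∈+ B \/ ~ b ∈- B -> exists a, G a b).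
  { intros b Hb. destruct (classic (b ∈+ B)) as [H1|H1], (classic (b ∈- B)) as [H2|H2].
    - destruct (jS b) as (a & Ha & K); [apply (HD' b); auto|]. exists a. right. left. auto.
    - destruct (iS b) as (a & Ha & K); [apply (HT' b); auto|]. exists a. left. auto.
    - tauto.
    - destruct (hS b) as (a & Ha & K); [apply (HN' b); auto|]. exists a. right. right. auto. }
  destruct (count_ex (fun x y => x = y) B) as (g & Hg & Kg).
  { red. dfn. } { eauto. } { congruence. } { congruence. }
  exists f. split; [exact Hf|]. exists g. split; [exact Hg|].
  destruct (image_ex A f Hf) as [u Hu]. exists u. split; [exact Hu|].
  intros b. destruct (Hu b) as [-> ->]. split; split.
  - intros (a & H & Ha). apply Kf in H as [_ H]. apply val in H. exists b.
    rewrite Kg. tauto.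
  - intros (b' & H & Hb). apply Kg in H as [Hb' ->]. destruct (onto b Hb') as [a Ha].
    exists a. rewrite Kf. apply val in Ha as H. tauto.
  - intros H b' Hb. apply Kg in Hb as [Hb' ->]. destruct (onto b Hb') as [a Ha].
    apply val in Ha as Va. apply Va, H, Kf. tauto.
  - intros H a Ha. apply Kf in Ha as [Va Ha]. apply val in Ha. apply Ha, H, Kg. tauto.
Qed.

Lemma not_eq_neg_images_embeds A B f g u v P Q T D N P' Q' T' D' N' :
  parts A P Q T D N -> parts B P' Q' T' D' N' ->
  is_count A f -> is_count B g -> is_image f A u -> is_image g B v -> ~ eq_neg M u v ->
  (exists h, embeds h P Q') /\ (exists h, embeds h D N').
Proof.
  intros [HP HQ HT HD HN] [HP' HQ' HT' HD' HN'] Hf Hg Hu Hv Hn. rewrite eq_neg_iff in Hn.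
  pose proof Hf as Hf'. pose proof Hg as Hg'.
  apply is_count_iff in Hf' as [[[_ [_ F]] I] Hd], Hg' as [[[_ [_ G]] J] He].
  (* Otherwise f(a) would be true in [u] and false in [v], against [Hn]. *)
  assert (to : forall a, a ∈+ A -> exists b, glued f g a b /\ ~ b ∈- B).
  { intros a Ha. destruct (proj2 (Hd a)) as [y Hy]; [auto|]. apply NNPP. intros N0.
    apply Hn. exists y. left. split; [apply Hu; eauto|]. apply Hv. intros b Hb.
    apply NNPP. intros Nb. apply N0. exists b. split; [exists y; auto|exact Nb]. }
  assert (fro : forall b, b ∈+ B -> exists a, glued f g a b /\ ~ a ∈- A).
  { intros b Hb. destruct (proj2 (He b)) as [y Hy]; [auto|]. apply NNPP. intros N0.
    apply Hn. exists y. right. split; [|apply Hv; eauto]. apply Hu. intros a Ha.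
    apply NNPP. intros Na. apply N0. exists a. split; [exists y; auto|exact Na]. }
  split; apply (glued_embeds A f B g); auto.
  - intros a Ha. apply (HP a) in Ha. destruct (to a Ha) as (b & Hb & Nb). exists b.
    split; [exact Hb|]. now apply (HQ' b).
  - intros a Ha. apply (HD a) in Ha as [Ha Na]. destruct (to a Ha) as (b & Hb & Nb).
    exists b. split; [exact Hb|]. apply (HN' b). split; [exact Nb|]. intros Pb.
    destruct (fro b Pb) as (a' & Ha' & Na'). apply Na'.
    rewrite (glued_fun B g f A b a' a); auto using glued_sym.
Qed.

Lemma images_not_eq_neg_of_embeds A B P Q T D N P' Q' T' D' N' i i' j j' :
  parts A P Q T D N -> parts B P' Q' T' D' N' ->
  embeds i P Q' -> embeds i' P' Q -> embeds j D N' -> embeds j' D' N ->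
  exists f, is_count A f /\ exists g, is_count B g /\
    exists u, is_image f A u /\ exists v, is_image g B v /\ ~ eq_neg M u v.
Proof.
  intros [HP HQ HT HD HN] [HP' HQ' HT' HD' HN'] Hi Hi' Hj Hj'.
  destruct (refine_embedding i j P Q' D N' Hi Hj) as (h & Hh & Ph).
  { intros x Hx. apply (HP x). now apply (HD x) in Hx. }
  { intros x Hx. apply (HQ' x). now apply (HN' x) in Hx. }
  destruct (refine_embedding i' j' P' Q D' N Hi' Hj') as (h' & Hh' & Ph').
  { intros x Hx. apply (HP' x). now apply (HD' x) in Hx. }
  { intros x Hx. apply (HQ x). now apply (HN x) in Hx. }
  destruct (common_matching h h' P P' Q Q' Hh Hh') as (m & M0 & M1 & M2 & M3 & M4).
  (* If the pair comes from [h], then b is in B^? by the range of [h]. If it comes from [h'] and b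
     were false in [B], then b would be in B_b, and the refinement would put a into A_n, although a
     is in A^!. *)
  assert (pot_r : forall a b, pair_mem a b m -> a ∈+ A -> ~ b ∈- B).
  { intros a b H Ha Hb. destruct (M0 a b H) as [[K1 K2]|[K1 K2]].
    - apply (emb_range _ _ _ Hh) in K2; [|exact K1]. now apply (HQ' b) in K2.
    - apply (HP' b) in K1. apply Ph' in K2; [|now apply (HD' b)]. now apply (HN a) in K2. }
  assert (pot_l : forall a b, pair_mem a b m -> b ∈+ B -> ~ a ∈- A).
  { intros a b H Hb Ha. destruct (M0 a b H) as [[K1 K2]|[K1 K2]].
    - apply (HP a) in K1. apply Ph in K2; [|now apply (HD a)]. now apply (HN' b) in K2.
    - apply (emb_range _ _ _ Hh') in K2; [|exact K1]. now apply (HQ a) in K2. }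
  (* Second coordinates for the values: [f] sends a to (a,∅), while [g] sends b to (a,∅) if [m]
     matches a with b, and to (b,{∅}) if b has no partner. As ∅ ≠ {∅}, values of unmatched members
     of [B] avoid the range of [f]. *)
  destruct empty_ex as [o Ho]. destruct (upair_ex o o) as [s Hs].
  assert (os : o <> s).
  { intros <-. now apply (sing_not_empty o o). }
  destruct (count_ex (fun a y => is_opair a o y) A) as (f & Hf & Kf).
  { red. dfn. }
  { intros a _. apply opair_ex. }
  { intros a y z. apply opair_unique. }
  { intros a a' y H K. now destruct (opair_inj _ _ _ _ _ H K). }
  destruct (count_ex (fun b y => (exists a, pair_mem a b m /\ is_opair a o y) \/
    (~ (exists a, pair_mem a b m) /\ is_opair b s y)) B) as (g & Hg & Kg).
  { red. dfn. }
  { intros b _. destruct (classic (exists a, pair_mem a b m)) as [[a Ha]|Na].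
    - destruct (opair_ex a o) as [y Hy]. eauto.
    - destruct (opair_ex b s) as [y Hy]. eauto. }
  { intros b y z [(a & Ha & Hy)|(Na & Hy)] [(a' & Ha' & Hz)|(Na' & Hz)].
    - rewrite (M2 a' a b) in Hz by auto. now apply (opair_unique a o).
    - exfalso. eauto.
    - exfalso. eauto.
    - now apply (opair_unique b s). }
  { intros b b' y [(a & Ha & Hy)|(Na & Hy)] [(a' & Ha' & Hz)|(Na' & Hz)];
      destruct (opair_inj _ _ _ _ _ Hy Hz) as [E1 E2].
    - subst a'. eauto.
    - now destruct (os E2).
    - now destruct os.
    - exact E1. }
  exists f. split; [exact Hf|]. exists g. split; [exact Hg|].
  destruct (image_ex A f Hf) as [u Hu]. destruct (image_ex B g Hg) as [v Hv].
  exists u. split; [exact Hu|]. exists v. split; [exact Hv|].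
  rewrite eq_neg_iff. intros (y & [[Y1 Y2]|[Y1 Y2]]).
  - apply Hu in Y1 as (a & Ha & Pa). apply Kf in Ha as [_ Ha].
    destruct (M3 a) as [b Hb]; [now apply (HP a)|].
    assert (Nb : ~ b ∈- B) by eauto. apply Nb, (proj1 (proj2 (Hv y)) Y2 b), Kg.
    split; [now right|left; eauto].
  - apply Hv in Y2 as (b & Hb & Pb). apply Kg in Hb as [_ Hb].
    destruct (M4 b) as [a Ha]; [now apply (HP' b)|].
    assert (Na : ~ a ∈- A) by eauto.
    destruct Hb as [(a' & Ha' & Hy)|[N0 _]]; [|exfalso; eauto].
    rewrite (M2 a' a b) in Hy by auto. apply Na, (proj1 (proj2 (Hu y)) Y1 a), Kf. auto.
Qed.

End Cardinals.

Theorem theorem5p2 :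
  entails BZFC (close (∀ A B, card_eq A B ⇔ equinumerous A B)%bs4).
Proof.
  intros M HM. assert (HM' : bzfc_model M) by exact HM. apply theorem_reduction. intros A B.
  destruct (card_ex A) as [k Hk], (card_ex B) as [l Hl].
  destruct (parts_ex A) as (P & Q & T & D & N & HA).
  destruct (parts_ex B) as (P' & Q' & T' & D' & N' & HB).
  destruct (card_compare A B k l _ _ _ _ _ _ _ _ _ _ HA HB Hk Hl) as [ET EF].
  split; split.
  - intros (k' & Hk' & l' & Hl' & E).
    rewrite (card_unique A k' k), (card_unique B l' l) in E by assumption.
    apply ET in E as (_ & _ & E1 & E2 & E3).
    destruct (equal_images_of_equipotent A B _ _ _ _ _ _ _ _ _ _ HA HB E1 E2 E3)
      as (f & Hf & g & Hg & u & Hu & Hv). eauto 10.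
  - intros (f & Hf & g & Hg & u & Hu & v & Hv & <-).
    exists k. split; [exact Hk|]. exists l. split; [exact Hl|]. apply ET.
    destruct HA, HB.
    split; [|split; [|split; [|split]]].
    + now apply (image_eq_equipotent A B f g u (fun p q => p)); auto; tauto.
    + now apply (image_eq_equipotent A B f g u (fun p q => ~ q)); auto; tauto.
    + now apply (image_eq_equipotent A B f g u (fun p q => p /\ ~ q)); auto; tauto.
    + now apply (image_eq_equipotent A B f g u (fun p q => p /\ q)); auto; tauto.
    + now apply (image_eq_equipotent A B f g u (fun p q => ~ q /\ ~ p)); auto; tauto.
  - intros H. specialize (H k Hk l Hl). intros f Hf g Hg u Hu v Hv. apply NNPP. intros Nuv.
    apply EF in H. apply H.
    destruct (not_eq_neg_images_embeds A B f g u v _ _ _ _ _ _ _ _ _ _ HA HB Hf Hg Hu Hv Nuv).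
    destruct (not_eq_neg_images_embeds B A g f v u _ _ _ _ _ _ _ _ _ _ HB HA Hg Hf Hv Hu); auto.
    intros K. now apply Nuv, eq_neg_sym.
  - intros H k' Hk' l' Hl'. rewrite (card_unique A k' k), (card_unique B l' l) by assumption.
    apply EF. intros ((i & Hi) & (i' & Hi') & (j & Hj) & (j' & Hj')).
    destruct (images_not_eq_neg_of_embeds A B _ _ _ _ _ _ _ _ _ _ i i' j j' HA HB Hi Hi' Hj Hj')
      as (f & Hf & g & Hg & u & Hu & v & Hv & K). eauto.
Qed.
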